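(* Let $A$ be a Hopf $*$-algebra, $(\Omega^{(\bullet,\bullet)},\wedge,\partial,\overline\partial)$ an $A$-covariant complex structure on a left $A$-comodule $*$-algebra $B$, and $(\mathcal E,\overline\partial_{\mathcal E})$ an $A$-covariant holomorphic bimodule in ${}^A_B\mathsf{Mod}_B$. Let $\gamma$ be a unitary $2$-cocycle on $A$ and define $$\overline\partial_{\Gamma(\mathcal E)}:=\varphi^{-1}_{\Omega^{(0,1)},\mathcal E}\,\Gamma(\overline\partial_{\mathcal E}):\Gamma(\mathcal E)\to\Omega^{(0,1)}_\gamma\otimes_{B_\gamma}\Gamma(\mathcal E).$$ Then $(\Gamma(\mathcal E),\overline\partial_{\Gamma(\mathcal E)})$ is an $A_\gamma$-covariant holomorphic bimodule in ${}^{A_\gamma}_{B_\gamma}\mathsf{Mod}_{B_\gamma}$ (with respect to the deformed complex structure $(\Omega^{(\bullet,\bullet)}_\gamma,\wedge_\gamma,\partial_\gamma,(\overline\partial)_\gamma)$).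
   Context: Hopf algebras and modules. Algebras are unital over $\mathbb C$, $\otimes=\otimes_{\mathbb C}$, Hopf algebras $(A,\Delta,\epsilon,S)$ have bijective antipode. A Hopf $*$-algebra is a Hopf algebra that is a $*$-algebra with $\Delta$ a $*$-homomorphism. Sweedler notation: $\Delta(a)=a_{(1)}\otimes a_{(2)}$; left coactions are $v\mapsto v_{(-1)}\otimes v_{(0)}$. A left $A$-comodule $*$-algebra is a left $A$-comodule algebra $B$ that is a $*$-algebra whose coaction is a $*$-homomorphism. ${}^A_B\mathsf{Mod}_B$ is the category of $B$-bimodules with a left $A$-coaction satisfying $\delta(aeb)=\delta(a)\delta(e)\delta(b)$; morphisms are $A$-colinear $B$-bilinear maps; it is monoidal under $\otimes_B$. Cocycles. A $2$-cocycle on $A$ is a convolution-invertible linear $\gamma:A\otimes A\to\mathbb C$ (inverse $\bar\gamma$) with $\gamma(g_{(1)}\otimes h_{(1)})\gamma(g_{(2)}h_{(2)}\otimes k)=\gamma(h_{(1)}\otimes k_{(1)})\gamma(g\otimes h_{(2)}k_{(2)})$, always assumed unital: $\gamma(h\otimes1)=\epsilon(h)=\gamma(1\otimes h)$. It is unitary if $\overline{\gamma(a\otimes b)}=\bar\gamma(S(a)^*\otimes S(b)^* )$. Put $U(k)=\gamma(k_{(1)}\otimes S(k_{(2)}))$, $\bar U(k)=\bar\gamma(S(k_{(1)})\otimes k_{(2)})$, $V=U\circ S^{-1}$, $\bar V=\bar U\circ S^{-1}$, so $\bar V(k)=\bar\gamma(k_{(2)}\otimes S^{-1}(k_{(1)}))$.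 For unitary $\gamma$, $A_\gamma$ is the Hopf $*$-algebra with the coalgebra $A$, product $h\cdot_\gamma k=\gamma(h_{(1)}\otimes k_{(1)})h_{(2)}k_{(2)}\bar\gamma(h_{(3)}\otimes k_{(3)})$, antipode $S_\gamma(h)=U(h_{(1)})S(h_{(2)})\bar U(h_{(3)})$, involution $h^{*_\gamma}=\bar V(h_{(1)}^* )h_{(2)}^*V(h_{(3)}^* )$. $B_\gamma$ is the left $A_\gamma$-comodule $*$-algebra with underlying comodule $B$, $a\cdot_\gamma b=\gamma(a_{(-1)}\otimes b_{(-1)})a_{(0)}b_{(0)}$, $b^{*_\gamma}=\bar V(b_{(-1)}^* )b_{(0)}^*$. The functor $\Gamma:{}^A_B\mathsf{Mod}_B\to{}^{A_\gamma}_{B_\gamma}\mathsf{Mod}_{B_\gamma}$ is the identity on underlying comodules and maps, with actions $b\cdot_\gamma m=\gamma(b_{(-1)}\otimes m_{(-1)})b_{(0)}m_{(0)}$, $m\cdot_\gamma b=\gamma(m_{(-1)}\otimes b_{(-1)})m_{(0)}b_{(0)}$; it is monoidal via $\varphi_{V,W}:\Gamma(V)\otimes_{B_\gamma}\Gamma(W)\to\Gamma(V\otimes_BW)$, $v\otimes_{B_\gamma}w\mapsto\gamma(v_{(-1)}\otimes w_{(-1)})v_{(0)}\otimes_Bw_{(0)}$. $\Gamma$ is also applied (as the identity on underlying maps) to $A$-colinear linear maps. Calculi. An $A$-covariant differential calculus over $B$ is a differential graded algebra $(\Omega^\bullet=\bigoplus_{k\ge0}\Omega^k,\wedge,d)$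 with $\Omega^0=B$, generated as an algebra by $B$ and $dB$, such that the coaction of $B$ extends to a comodule algebra structure on $\Omega^\bullet$ with each $\Omega^k$ in ${}^A_B\mathsf{Mod}_B$ and $d$ $A$-colinear. It is an $A$-covariant $*$-differential calculus if the involution of $B$ extends to a conjugate-linear involution of $\Omega^\bullet$ preserving each $\Omega^k$, with $(d\omega)^*=d(\omega^* )$, $(\omega\wedge\nu)^*=(-1)^{kl}\nu^*\wedge\omega^*$ for $\omega\in\Omega^k,\nu\in\Omega^l$, compatible with the coaction. Its deformation $\Omega^k_\gamma=\Gamma(\Omega^k)$, $d_\gamma=\Gamma(d)$, $\omega\wedge_\gamma\eta=\gamma(\omega_{(-1)}\otimes\eta_{(-1)})\omega_{(0)}\wedge\eta_{(0)}$, $\omega^{*_\gamma}=\bar V(\omega_{(-1)}^* )\omega_{(0)}^*$ is an $A_\gamma$-covariant $*$-differential calculus on $B_\gamma$. Complex structures. A complex structure on a $*$-calculus is an $\mathbb N_0^2$-algebra grading $\Omega^\bullet=\bigoplus\Omega^{(p,q)}$ with $\Omega^k=\bigoplus_{p+q=k}\Omega^{(p,q)}$, $(\Omega^{(p,q)})^*=\Omega^{(q,p)}$, $d\Omega^{(p,q)}\subseteq\Omega^{(p+1,q)}\oplus\Omega^{(p,q+1)}$; $\pi^{p,q}:\Omega^{p+q}\to\Omega^{(p,q)}$ are the projections, $\partial=\pi^{p+1,q}\circ d$ and $\overline\partial=\pi^{p,q+1}\circ d$ on $\Omega^{(p,q)}$. It is $A$-covariant if the calculus is an $A$-covariant $*$-calculus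 and each $\Omega^{(p,q)}$ is a left $A$-(sub)comodule. The deformed complex structure, which is $A_\gamma$-covariant on $B_\gamma$, is $\Omega^{(p,q)}_\gamma=\Gamma(\Omega^{(p,q)})$, $\partial_\gamma=\Gamma(\partial)$, $(\overline\partial)_\gamma=\Gamma(\overline\partial)$. Holomorphic bimodules. A covariant holomorphic bimodule is a pair $(\mathcal E,\overline\partial_{\mathcal E})$ with $\mathcal E$ in ${}^A_B\mathsf{Mod}_B$ and $\overline\partial_{\mathcal E}:\mathcal E\to\Omega^{(0,1)}\otimes_B\mathcal E$ an $A$-colinear $\mathbb C$-linear map with $\overline\partial_{\mathcal E}(be)=b\,\overline\partial_{\mathcal E}(e)+\overline\partial(b)\otimes_Be$ for $b\in B,e\in\mathcal E$, and vanishing holomorphic curvature $R^{\mathrm{Hol}}_{\mathcal E}=(\overline\partial\otimes_B\mathrm{id}-\mathrm{id}\wedge\overline\partial_{\mathcal E})\overline\partial_{\mathcal E}:\mathcal E\to\Omega^{(0,2)}\otimes_B\mathcal E$. *)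

(* Defs.v *)
From HB Require Import structures.
From mathcomp Require Import all_boot all_order all_algebra.
From mathcomp Require Import boolp classical_sets reals.
From mathcomp Require Import generic_quotient complex.

Set Implicit Arguments.
Unset Strict Implicit.
Unset Printing Implicit Defensive.

Import Order.TTheory GRing.Theory Num.Theory.
Local Open Scope ring_scope.
Local Open Scope quotient_scope.

(* ------------------------------------------------------------------------ *)
(* Tensor products of vector spaces of arbitrary dimension, over an          *)
(* arbitrary (noncommutative) algebra B acting by                            *)
(*   ra : M -> B -> M   and   la : B -> N -> N.                              *)
(* Formal finite sums of pairs (m, n) are sequences; [teq] is the smallest   *)
(* congruence for concatenation and scaling that makes concatenation         *)
(* commutative and (m, n) biadditive and B-balanced.  M (x)_K N is the       *)
(* instance B = K.                                                           *)
(* ------------------------------------------------------------------------ *)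

Section Tensor.
Variables (K : comNzRingType) (M N : lmodType K) (B : Type).
Variables (ra : M -> B -> M) (la : B -> N -> N).

Definition fscale (c : K) (s : seq (M * N)) : seq (M * N) :=
  [seq (c *: p.1, p.2) | p <- s].

Inductive teq : seq (M * N) -> seq (M * N) -> Prop :=
| teq_refl s : teq s s
| teq_sym s t : teq s t -> teq t s
| teq_trans s t u : teq s t -> teq t u -> teq s u
| teq_cat s s' t t' : teq s s' -> teq t t' -> teq (s ++ t) (s' ++ t')
| teq_scale c s t : teq s t -> teq (fscale c s) (fscale c t)
| teq_comm s t : teq (s ++ t) (t ++ s)
| teq_zero n : teq [:: (0, n)] [::]
| teq_addl m m' n : teq [:: (m + m', n)] [:: (m, n); (m', n)]
| teq_addr m n n' : teq [:: (m, n + n')] [:: (m, n); (m, n')]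
| teq_bal m b n : teq [:: (ra m b, n)] [:: (m, la b n)].

Definition teqb : rel (seq (M * N)) := fun s t => `[< teq s t >].

Lemma teqb_refl : reflexive teqb.
Proof. by move=> s; apply/asboolP; apply: teq_refl. Qed.

Lemma teqb_sym : symmetric teqb.
Proof. by move=> s t; apply/asboolP/asboolP; apply: teq_sym. Qed.

Lemma teqb_trans : transitive teqb.
Proof.
by move=> t s u /asboolP st /asboolP tu; apply/asboolP; apply: teq_trans tu.
Qed.

Canonical teq_equiv := EquivRel teqb teqb_refl teqb_sym teqb_trans.

Definition tens := {eq_quot teq_equiv}.
HB.instance Definition _ := Choice.on tens.
HB.instance Definition _ := EqQuotient.on tens.

Lemma teq_pi s t : teq s t -> \pi_tens s = \pi_tens t.
Proof. by move=> st; apply/eqmodP/asboolP. Qed.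

Lemma teq_repr s : teq (repr (\pi_tens s)) s.
Proof. by apply/asboolP; apply/(@eqmodP _ teq_equiv); rewrite reprK. Qed.

Definition tadd (x y : tens) : tens := \pi_tens (repr x ++ repr y).
Definition tscale (c : K) (x : tens) : tens :=
  \pi_tens (fscale c (repr x)).
Definition tzero : tens := \pi_tens [::].
Definition topp (x : tens) : tens := tscale (-1) x.

Lemma tadd_pi s t :
  tadd (\pi_tens s) (\pi_tens t) = \pi_tens (s ++ t).
Proof. by apply: teq_pi; apply: teq_cat; apply: teq_repr. Qed.

Lemma tscale_pi c s : tscale c (\pi_tens s) = \pi_tens (fscale c s).
Proof. by apply: teq_pi; apply: teq_scale; apply: teq_repr. Qed.

Lemma tens_ind (P : tens -> Prop) :
  (forall s, P (\pi_tens s)) -> forall x, P x.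
Proof. by move=> Ps x; rewrite -[x]reprK. Qed.

Lemma taddA : associative tadd.
Proof.
elim/tens_ind=> s; elim/tens_ind=> t; elim/tens_ind=> u.
by rewrite !tadd_pi catA.
Qed.

Lemma taddC : commutative tadd.
Proof.
elim/tens_ind=> s; elim/tens_ind=> t.
by rewrite !tadd_pi; apply/teq_pi/teq_comm.
Qed.

Lemma tadd0 : left_id tzero tadd.
Proof. by elim/tens_ind=> s; rewrite tadd_pi. Qed.

Lemma tscaleDl (x : tens) (c d : K) :
  tscale (c + d) x = tadd (tscale c x) (tscale d x).
Proof.
elim/tens_ind: x => s; rewrite !tscale_pi tadd_pi; apply: teq_pi.
elim: s => [|[m n] s IHs] /=; first exact: teq_refl.
rewrite scalerDl.
have step1 := teq_cat (teq_addl (c *: m) (d *: m) n) IHs.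
apply: teq_trans step1 _ => /=.
rewrite -(cat1s (c *: m, n)) -[X in teq _ X]cat1s.
apply: teq_cat; first exact: teq_refl.
rewrite -(cat1s (d *: m, n)) catA -[in X in teq _ X](cat1s (d *: m, n)) catA.
by apply: teq_cat; [exact: teq_comm | exact: teq_refl].
Qed.

Lemma tscale0 (x : tens) : tscale 0 x = tzero.
Proof.
elim/tens_ind: x => s; rewrite tscale_pi; apply: teq_pi.
elim: s => [|[m n] s IHs] /=; first exact: teq_refl.
by rewrite scale0r; exact: (teq_cat (teq_zero n) IHs).
Qed.

Lemma tscale1 : left_id 1 tscale.
Proof.
elim/tens_ind=> s; rewrite tscale_pi; congr (\pi_tens _).
by rewrite /fscale -[RHS]map_id; apply: eq_map => -[m n] /=; rewrite scale1r.
Qed.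

Lemma taddN : left_inverse tzero topp tadd.
Proof.
move=> x; rewrite /topp -[in X in tadd _ X](tscale1 x).
by rewrite -tscaleDl addNr tscale0.
Qed.

HB.instance Definition _ := GRing.isZmodule.Build tens taddA taddC tadd0 taddN.

Lemma tscaleA c d (x : tens) : tscale c (tscale d x) = tscale (c * d) x.
Proof.
elim/tens_ind: x => s; rewrite !tscale_pi; congr (\pi_tens _).
by rewrite /fscale -map_comp; apply: eq_map => p /=; rewrite scalerA.
Qed.

Lemma tscaleDr : right_distributive tscale +%R.
Proof.
move=> c; elim/tens_ind=> s; elim/tens_ind=> t.
by rewrite -[LHS]/(tscale c (tadd _ _)) tadd_pi !tscale_pi -[RHS]/(tadd _ _)
           tadd_pi /fscale map_cat.
Qed.

HB.instance Definition _ :=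
  GRing.Zmodule_isLmodule.Build K tens tscaleA tscale1 tscaleDr
    (fun x c d => tscaleDl x c d).

Definition tpure (m : M) (n : N) : tens := \pi_tens [:: (m, n)].

(* The map induced on the tensor product by f; it does not depend on the
   representative chosen by repr as soon as f is balanced, see [tlift_pi]. *)
Definition tlift (W : zmodType) (f : M -> N -> W) (t : tens) : W :=
  \sum_(p <- repr t) f p.1 p.2.

Lemma tpi_cons p s : \pi_tens (p :: s) = tpure p.1 p.2 + \pi_tens s.
Proof. by case: p => m n; rewrite -[RHS]/(tadd _ _) tadd_pi. Qed.

Lemma tpi_sum s : \pi_tens s = \sum_(p <- s) tpure p.1 p.2.
Proof.
by elim: s => [|p s IHs]; rewrite ?big_nil // tpi_cons big_cons IHs.
Qed.

Lemma tens_sum (t : tens) : t = \sum_(p <- repr t) tpure p.1 p.2.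
Proof. by rewrite -tpi_sum reprK. Qed.

Lemma tpureDl m m' n : tpure (m + m') n = tpure m n + tpure m' n.
Proof. by rewrite -[RHS]/(tadd _ _) tadd_pi; apply/teq_pi/teq_addl. Qed.

Lemma tpureDr m n n' : tpure m (n + n') = tpure m n + tpure m n'.
Proof. by rewrite -[RHS]/(tadd _ _) tadd_pi; apply/teq_pi/teq_addr. Qed.

Lemma tpureZl c m n : tpure (c *: m) n = c *: tpure m n.
Proof. by rewrite -[RHS]/(tscale _ _) tscale_pi. Qed.

Lemma tpure_bal m b n : tpure (ra m b) n = tpure m (la b n).
Proof. exact/teq_pi/teq_bal. Qed.

Section Lift.
(* g = id for bilinear f, g = conjugation for conjugate-bilinear f *)
Variables (W : lmodType K) (g : K -> K) (f : M -> N -> W).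
Hypotheses (fDl : forall m m' n, f (m + m') n = f m n + f m' n)
           (fDr : forall m n n', f m (n + n') = f m n + f m n')
           (fZl : forall c m n, f (c *: m) n = g c *: f m n)
           (fbal : forall m b n, f (ra m b) n = f m (la b n)).

Lemma teq_lift s t : teq s t ->
  \sum_(p <- s) f p.1 p.2 = \sum_(p <- t) f p.1 p.2.
Proof.
have scaleE c u : \sum_(p <- fscale c u) f p.1 p.2
                  = g c *: \sum_(p <- u) f p.1 p.2.
  by rewrite big_map scaler_sumr; apply: eq_bigr => p _ /=; rewrite fZl.
elim=> {s t}.
- by [].
- by [].
- by move=> s t u _ -> _ ->.
- by move=> s s' t t' _ es _ et; rewrite !big_cat /= es et.
- by move=> c s t _ est; rewrite !scaleE est.
- by move=> s t; rewrite !big_cat /= addrC.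
- move=> n; rewrite big_nil big_seq1 /=.
  by apply: (addrI (f 0 n)); rewrite -fDl !addr0.
- by move=> m m' n; rewrite !big_cons !big_nil /= !addr0 fDl.
- by move=> m n n'; rewrite !big_cons !big_nil /= !addr0 fDr.
- by move=> m b n; rewrite !big_seq1 /= fbal.
Qed.

Lemma tlift_pi s : tlift f (\pi_tens s) = \sum_(p <- s) f p.1 p.2.
Proof. exact/teq_lift/teq_repr. Qed.

End Lift.

End Tensor.

Arguments tens {K M N B} ra la.
Arguments tpure {K M N B ra la} m n.
Arguments tlift {K M N B ra la W} f t.

Definition tensC (K : comNzRingType) (M N : lmodType K) : lmodType K :=
  tens (fun (m : M) (c : K) => c *: m) (fun (c : K) (n : N) => c *: n).

Definition tpureC (K : comNzRingType) (M N : lmodType K) (m : M) (n : N) :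
  tensC M N := tpure m n.

Notation "m \ox n" := (tpureC m n)
  (at level 40, left associativity) : ring_scope.

(* Sweedler notation: for t = sum_i x_i (x) y_i this is sum_i F x_i y_i. *)
Notation "\Sw_( x , y <- t ) F" := (tlift (fun x y => F) t)
  (at level 41, F at level 41, x name, y name, t at level 100,
   format "\Sw_( x ,  y  <-  t )  F") : ring_scope.

(* The inverse of f when f is bijective; values outside the image of f are x0. *)
Definition inverse (X Y : choiceType) (x0 : X) (f : X -> Y) (y : Y) : X :=
  xget x0 [set x | f x = y].

(* ------------------------------------------------------------------------ *)
(* The same vector spaces carry two structures, the given one and the one    *)
(* deformed by the cocycle.  Operations are therefore kept in plain records, *)
(* separate from the predicates stating their axioms.                        *)
(* ------------------------------------------------------------------------ *)

Section Defs.
Variable R : realType.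
Notation C := R[i].

Record algebra := Algebra {
  acar :> lmodType C;
  amul : acar -> acar -> acar;
  aone : acar;
  astar : acar -> acar }.

Definition is_algebra (X : algebra) : Prop :=
  [/\ forall x : X, linear (amul x),
      forall y : X, linear (@amul X ^~ y),
      associative (@amul X),
      left_id (aone X) (@amul X) & right_id (aone X) (@amul X)].

Definition conj_linear (V : lmodType C) (f : V -> V) : Prop :=
  forall (c : C) (u v : V), f (c *: u + v) = Num.conj c *: f u + f v.

Definition is_star_algebra (X : algebra) : Prop :=
  [/\ is_algebra X,
      conj_linear (@astar X),
      involutive (@astar X) &
      forall x y : X, astar (amul x y) = amul (astar y) (astar x)].

Record hopf := Hopf {
  halg :> algebra;
  cop : halg -> tensC halg halg;
  cou : halg -> C;
  anti : halg -> halg }.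

Definition antiV (A : hopf) : A -> A := inverse 0 (@anti A).

(* Coassociativity and counitality; the two sides of the former are
   identified along (A (x) A) (x) V = A (x) (A (x) V). *)
Definition is_comodule (A : hopf) (V : lmodType C) (co : V -> tensC A V) :
    Prop :=
  [/\ linear co,
      forall v, \Sw_(a, w <- co v) \Sw_(a1, a2 <- cop a) a1 \ox (a2 \ox w)
              = \Sw_(a, w <- co v) \Sw_(b, u <- co w) a \ox (b \ox u) &
      forall v, \Sw_(a, w <- co v) cou a *: w = v].

Definition is_coalgebra (A : hopf) : Prop :=
  [/\ scalar (@cou A), is_comodule (@cop A) &
      forall a : A, \Sw_(a1, a2 <- cop a) cou a2 *: a1 = a].

Definition is_bialgebra (A : hopf) : Prop :=
  [/\ is_algebra A, is_coalgebra A,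
      forall a b : A, cop (amul a b)
        = \Sw_(a1, a2 <- cop a) \Sw_(b1, b2 <- cop b)
            amul a1 b1 \ox amul a2 b2,
      cop (aone A) = aone A \ox aone A &
      (forall a b : A, cou (amul a b) = cou a * cou b) /\ cou (aone A) = 1].

Definition is_hopf (A : hopf) : Prop :=
  [/\ is_bialgebra A, linear (@anti A), bijective (@anti A),
      forall a : A, \Sw_(a1, a2 <- cop a) amul (anti a1) a2
                    = cou a *: aone A &
      forall a : A, \Sw_(a1, a2 <- cop a) amul a1 (anti a2)
                    = cou a *: aone A].

Definition is_hopf_star_algebra (A : hopf) : Prop :=
  [/\ is_hopf A, is_star_algebra A &
      forall a : A, cop (astar a) = \Sw_(a1, a2 <- cop a) astar a1 \ox astar a2].

Record coalg_algebra (A : hopf) := CoalgAlgebra {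
  calg :> algebra;
  coact : calg -> tensC A calg }.

Definition is_comodule_algebra (A : hopf) (B : coalg_algebra A) : Prop :=
  [/\ is_algebra B, is_comodule (@coact A B),
      forall b b' : B, coact (amul b b')
        = \Sw_(x, c <- coact b) \Sw_(x', c' <- coact b')
            amul x x' \ox amul c c' &
      coact (aone B) = aone A \ox aone B].

Definition star_compatible (A : hopf) (B : coalg_algebra A) : Prop :=
  forall b : B, coact (astar b) = \Sw_(x, c <- coact b) astar x \ox astar c.

Definition is_comodule_star_algebra (A : hopf) (B : coalg_algebra A) : Prop :=
  [/\ is_comodule_algebra B, is_star_algebra B & star_compatible B].

Record bimod (A : hopf) (B : coalg_algebra A) := Bimod {
  bcar :> lmodType C;
  lact : B -> bcar -> bcar;
  ract : bcar -> B -> bcar;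
  bcoact : bcar -> tensC A bcar }.

Definition is_bimodule (A : hopf) (B : coalg_algebra A) (E : bimod B) : Prop :=
  [/\ (forall b : B, linear (@lact A B E b)) /\
      (forall e : E, linear (@lact A B E ^~ e)),
      (forall b : B, linear (@ract A B E ^~ b)) /\
      (forall e : E, linear (@ract A B E e)),
      (forall (a b : B) (e : E), lact a (lact b e) = lact (amul a b) e) /\
      (forall e : E, lact (aone B) e = e),
      (forall (a b : B) (e : E), ract (ract e a) b = ract e (amul a b)) /\
      (forall e : E, ract e (aone B) = e) &
      forall (a b : B) (e : E), ract (lact a e) b = lact a (ract e b)].

Definition is_cov_bimodule (A : hopf) (B : coalg_algebra A) (E : bimod B) :
    Prop :=
  [/\ is_bimodule E, is_comodule (@bcoact A B E) &
      forall (a b : B) (e : E), bcoact (ract (lact a e) b)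
        = \Sw_(x, a0 <- coact a) \Sw_(y, e0 <- bcoact e)
          \Sw_(z, b0 <- coact b)
            amul (amul x y) z \ox ract (lact a0 e0) b0].

Definition tensB_car (A : hopf) (B : coalg_algebra A) (V W : bimod B) :
    lmodType C :=
  tens (@ract A B V) (@lact A B W).

Definition tpureB (A : hopf) (B : coalg_algebra A) (V W : bimod B)
  (v : V) (w : W) : tensB_car V W := tpure v w.

Definition tensB (A : hopf) (B : coalg_algebra A) (V W : bimod B) : bimod B :=
  @Bimod A B (tensB_car V W)
    (fun b t => \Sw_(v, w <- t) tpureB (lact b v) w)
    (fun t b => \Sw_(v, w <- t) tpureB v (ract w b))
    (fun t => \Sw_(v, w <- t) \Sw_(x, v0 <- bcoact v) \Sw_(y, w0 <- bcoact w)
                amul x y \ox tpureB v0 w0).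

(* ctot is the total algebra, cB the inclusion of B in it; the graded pieces
   are covariant bimodules cOm k, with inclusions cinc k into ctot.  The field
   astar of ctot is a graded involution, so ctot is not required to satisfy
   is_star_algebra. *)

Record calculus (A : hopf) (B : coalg_algebra A) := Calculus {
  ctot :> coalg_algebra A;
  cB : B -> ctot;
  cd : ctot -> ctot;
  cOm : nat -> bimod B;
  cinc : forall k, cOm k -> ctot }.

Section Calculus.
Variables (A : hopf) (B : coalg_algebra A).

Definition is_inclusion (W : calculus B) (E : bimod B) (i : E -> W) : Prop :=
  [/\ linear i,
      forall (b : B) (e : E), i (lact b e) = amul (cB W b) (i e),
      forall (b : B) (e : E), i (ract e b) = amul (i e) (cB W b) &
      forall e : E, coact (i e) = \Sw_(x, e0 <- bcoact e) x \ox i e0].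

Definition is_cov_graded_algebra (W : calculus B) : Prop :=
  [/\ is_comodule_algebra W,
      forall k, is_cov_bimodule (cOm W k) /\ is_inclusion (@cinc _ _ W k),
      (forall w : W, exists n (f : forall k, cOm W k),
          w = \sum_(k < n) cinc (f k)) /\
      (forall n (f : forall k, cOm W k),
          \sum_(k < n) cinc (f k) = 0 -> forall k, (k < n)%N -> f k = 0) &
      forall k l (w : cOm W k) (v : cOm W l),
        exists u : cOm W (k + l), amul (cinc w) (cinc v) = cinc u].

Definition is_degree_zero (W : calculus B) : Prop :=
  [/\ linear (cB W) /\ injective (cB W),
      (range (cB W) = range (@cinc _ _ W 0))%classic,
      forall b b' : B, cB W (amul b b') = amul (cB W b) (cB W b'),
      cB W (aone B) = aone W &
      forall b : B, coact (cB W b) = \Sw_(x, b0 <- coact b) x \ox cB W b0].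

Definition is_cov_calculus (W : calculus B) : Prop :=
  [/\ is_cov_graded_algebra W /\ is_degree_zero W,
      [/\ linear (@cd _ _ W),
          forall k (w : cOm W k), exists v : cOm W k.+1, cd (cinc w) = cinc v,
          forall w : W, cd (cd w) = 0 &
          forall k (w : cOm W k) (v : W),
            cd (amul (cinc w) v)
            = amul (cd (cinc w)) v + (-1) ^+ k *: amul (cinc w) (cd v)],
      (* generated as an algebra by B and dB *)
      forall P : set W,
        (forall b, P (cB W b)) -> (forall b, P (cd (cB W b))) ->
        (forall (c : C) w v, P w -> P v -> P (c *: w + v)) ->
        (forall w v, P w -> P v -> P (amul w v)) ->
        forall w, P w &
      forall w : W, coact (cd w) = \Sw_(x, w0 <- coact w) x \ox cd w0].

Definition is_cov_star_calculus (W : calculus B) : Prop :=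
  [/\ is_cov_calculus W,
      conj_linear (@astar W) /\ involutive (@astar W),
      (forall b : B, astar (cB W b) = cB W (astar b)) /\
      (forall k (w : cOm W k), exists v : cOm W k, astar (cinc w) = cinc v),
      (forall w : W, astar (cd w) = cd (astar w)) /\
      (forall k l (w : cOm W k) (v : cOm W l),
          astar (amul (cinc w) (cinc v))
          = (-1) ^+ (k * l) *: amul (astar (cinc v)) (astar (cinc w))) &
      star_compatible W].

End Calculus.

Record complex_structure (A : hopf) (B : coalg_algebra A) := ComplexStructure {
  ccal :> calculus B;
  Om : nat -> nat -> bimod B;
  inc : forall p q, Om p q -> ccal }.

Section ComplexStructure.
Variables (A : hopf) (B : coalg_algebra A).

Definition is_cov_complex_structure (W : complex_structure B) : Prop :=
  [/\ is_cov_star_calculus W,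
      forall p q, is_cov_bimodule (Om W p q) /\ is_inclusion (@inc _ _ W p q),
      (* Omega^k is the direct sum of the Omega^(p,q) with p + q = k *)
      [/\ forall p q (w : Om W p q),
            exists v : cOm W (p + q), inc w = cinc v,
          forall k (v : cOm W k), exists f : forall p, Om W p (k - p),
            cinc v = \sum_(p < k.+1) inc (f p) &
          forall k (f : forall p, Om W p (k - p)),
            \sum_(p < k.+1) inc (f p) = 0 ->
            forall p, (p <= k)%N -> f p = 0],
      forall p q p' q' (w : Om W p q) (v : Om W p' q'),
        exists u : Om W (p + p') (q + q'), amul (inc w) (inc v) = inc u &
      (forall p q,
        (@astar W @` range (@inc _ _ W p q) = range (@inc _ _ W q p))%classic) /\
      (forall p q (w : Om W p q),
        exists (u : Om W p.+1 q) (v : Om W p q.+1),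
          cd (inc w) = inc u + inc v)].

Variable W : complex_structure B.

(* pi^{p,q} : the (p,q)-component of an element of Omega^(p+q) *)
Definition proj (p q : nat) (w : W) : Om W p q :=
  xget 0 [set u : Om W p q | exists f : nat -> W,
    [/\ forall i, range (@inc _ _ W i (p + q - i)) (f i),
        w = \sum_(i < (p + q).+1) f i & f p = inc u]].

Definition del (p q : nat) (w : Om W p q) : Om W p.+1 q :=
  proj p.+1 q (cd (inc w)).

Definition delbar (p q : nat) (w : Om W p q) : Om W p q.+1 :=
  proj p q.+1 (cd (inc w)).

(* delbar on B = Omega^(0,0) *)
Definition delbarB (b : B) : Om W 0 1 := proj 0 1 (cd (cB W b)).

(* the product Omega^(p,q) x Omega^(p',q') -> Omega^(p+p',q+q') *)
Definition wedge (p q p' q' : nat) (w : Om W p q) (v : Om W p' q') :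
    Om W (p + p') (q + q') :=
  proj (p + p') (q + q') (amul (inc w) (inc v)).

Section Holomorphic.
Variables (E : bimod B) (dE : E -> tensB (Om W 0 1) E).

(* delbar (x) id - id /\ delbar_E on Omega^(0,1) (x)_B E: the two terms are
   not B-balanced separately, but their difference is, by the Leibniz rules. *)
Definition delbar_twisted (t : tensB (Om W 0 1) E) : tensB (Om W 0 2) E :=
  \Sw_(w, e <- t)
    (tpureB (@delbar 0 1 w) e
     - \Sw_(v, e' <- dE e) tpureB (@wedge 0 1 0 1 w v) e').

Definition hol_curvature (e : E) : tensB (Om W 0 2) E := delbar_twisted (dE e).

Definition is_cov_hol_bimodule : Prop :=
  [/\ is_cov_bimodule E,
      linear dE,
      forall e : E, bcoact (dE e) = \Sw_(x, e0 <- bcoact e) x \ox dE e0,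
      forall (b : B) (e : E), dE (lact b e)
        = lact b (dE e) + tpureB (delbarB b) e &
      forall e : E, hol_curvature e = 0].

End Holomorphic.
End ComplexStructure.

Section Deformation.
Variable A : hopf.

(* g is a unital 2-cocycle on A with convolution inverse gb *)
Definition is_2cocycle (g gb : {scalar tensC A A}) : Prop :=
  [/\ (forall a b : A, \Sw_(a1, a2 <- cop a) \Sw_(b1, b2 <- cop b)
         (g (a1 \ox b1) * gb (a2 \ox b2) : C) = cou a * cou b) /\
      (forall a b : A, \Sw_(a1, a2 <- cop a) \Sw_(b1, b2 <- cop b)
         (gb (a1 \ox b1) * g (a2 \ox b2) : C) = cou a * cou b),
      forall a b c : A,
        \Sw_(a1, a2 <- cop a) \Sw_(b1, b2 <- cop b)
          (g (a1 \ox b1) * g (amul a2 b2 \ox c) : C)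
        = \Sw_(b1, b2 <- cop b) \Sw_(c1, c2 <- cop c)
          (g (b1 \ox c1) * g (a \ox amul b2 c2) : C) &
      forall a : A, g (a \ox aone A) = cou a /\ g (aone A \ox a) = cou a].

Definition is_unitary_2cocycle (g gb : {scalar tensC A A}) : Prop :=
  is_2cocycle g gb /\
  forall a b : A,
    Num.conj (g (a \ox b) : C)
    = gb (astar (anti a) \ox astar (anti b)).

Variables g gb : {scalar tensC A A}.

Definition coU (k : A) : C := \Sw_(k1, k2 <- cop k) g (k1 \ox anti k2).
Definition coUb (k : A) : C := \Sw_(k1, k2 <- cop k) gb (anti k1 \ox k2).
Definition coV (k : A) : C := coU (antiV k).
Definition coVb (k : A) : C := coUb (antiV k).

(* the sum of F h_(1) h_(2) h_(3), with iterated coproduct (cop (x) id) o cop *)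
Definition Sw3 (W : zmodType) (F : A -> A -> A -> W) (h : A) : W :=
  \Sw_(x, h3 <- cop h) \Sw_(h1, h2 <- cop x) F h1 h2 h3.

Definition deform_hopf : hopf :=
  @Hopf (@Algebra A
      (fun h k => Sw3 (fun h1 h2 h3 => Sw3 (fun k1 k2 k3 =>
         (g (h1 \ox k1) * gb (h3 \ox k3) : C) *: amul h2 k2) k) h)
      (aone A)
      (fun h => Sw3 (fun h1 h2 h3 =>
         (coVb (astar h1) * coV (astar h3)) *: astar h2) h))
    (@cop A) (@cou A)
    (fun h => Sw3 (fun h1 h2 h3 => (coU h1 * coUb h3) *: anti h2) h).

Definition deform_alg (B : coalg_algebra A) : coalg_algebra deform_hopf :=
  @CoalgAlgebra deform_hopf (@Algebra B
      (fun a b => \Sw_(x, a0 <- coact a) \Sw_(y, b0 <- coact b)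
         (g (x \ox y) : C) *: amul a0 b0)
      (aone B)
      (fun b => \Sw_(x, b0 <- coact b) coVb (astar x) *: astar b0))
    (@coact A B).

Variable B : coalg_algebra A.

(* The functor Gamma on objects; on morphisms it is the identity. *)
Definition Gamma (E : bimod B) : bimod (deform_alg B) :=
  @Bimod deform_hopf (deform_alg B) E
    (fun (b : B) (m : E) => \Sw_(x, b0 <- coact b) \Sw_(y, m0 <- bcoact m)
       (g (x \ox y) : C) *: lact b0 m0)
    (fun (m : E) (b : B) => \Sw_(x, m0 <- bcoact m) \Sw_(y, b0 <- coact b)
       (g (x \ox y) : C) *: ract m0 b0)
    (@bcoact A B E).

Definition phi (V W : bimod B) (t : tensB (Gamma V) (Gamma W)) :
    Gamma (tensB V W) :=
  \Sw_(v, w <- t) \Sw_(x, v0 <- @bcoact A B V v) \Sw_(y, w0 <- @bcoact A B W w)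
    (g (x \ox y) : C) *: (tpureB v0 w0 : tensB V W).

Definition phiV (V W : bimod B) :
    Gamma (tensB V W) -> tensB (Gamma V) (Gamma W) :=
  inverse 0 (@phi V W).

Definition deform_calculus (W : calculus B) : calculus (deform_alg B) :=
  @Calculus deform_hopf (deform_alg B) (deform_alg W)
    (cB W) (@cd A B W) (fun k => Gamma (cOm W k)) (@cinc A B W).

Definition deform_complex (W : complex_structure B) :
    complex_structure (deform_alg B) :=
  @ComplexStructure deform_hopf (deform_alg B) (deform_calculus W)
    (fun p q => Gamma (Om W p q)) (@inc A B W).

(* delbar_{Gamma(E)} = phi^{-1} o Gamma(delbar_E) *)
Definition deform_delbar (W : complex_structure B) (E : bimod B)
    (dE : E -> tensB (Om W 0 1) E) :
    Gamma E -> tensB (Om (deform_complex W) 0 1) (Gamma E) :=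
  fun e => phiV (dE e : Gamma (tensB (Om W 0 1) E)).

End Deformation.
End Defs.

Arguments deform_hopf {R A} g gb.
Arguments deform_alg {R A} g gb B.
Arguments Gamma {R A} g gb {B} E.
Arguments phi {R A} g gb {B} V W t.
Arguments phiV {R A} g gb {B} V W t.
Arguments deform_calculus {R A} g gb {B} W.
Arguments deform_complex {R A} g gb {B} W.
Arguments deform_delbar {R A} g gb {B W E} dE e.

(* Main.v *)
Require Import Defs.
From mathcomp Require Import all_boot all_order all_algebra.
From mathcomp Require Import boolp classical_sets reals.
From mathcomp Require Import complex.

(** Write [gam] for the cocycle [g], [gam'] for its inverse [gb], and, for a
    bilinear map [k : V -> W -> Z] between comodules,
      [twist g k v w = gam(v_(-1), w_(-1)) k(v_0, w_0)].
    The product of [B_gam], both actions on [Gamma E], the product of the deformed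
    forms and the map [phi] on pure tensors are of this form.  The proof rests on
    one principle ([twist_assoc]): if [mu] and [nu] respect the coactions and
    [k(mu(u, v), w) = l(u, nu(v, w))], then the twists of the four maps satisfy
    the same law.  Indeed the two sides carry the weights
    [gam(u1, v1) gam(u2 v2, w)] and [gam(v1, w1) gam(u, v2 w2)], which the
    cocycle identity equates.

    Instances of this principle are the bimodule axioms of [Gamma E], the fact
    that [phi] is balanced over [B_gam], its left [B_gam]-linearity, and, in the
    curvature, the passage from [(w /\ v) (x) e] to [w /\ (v (x) e)].  The same
    law for [gam'] ([twist_assoc_inv]) shows that
    [psi(v (x) w) = gam'(v_(-1), w_(-1)) v_0 (x) w_0] is balanced over [B], and
    [psi] inverts [phi] since twisting composes by convolution.  Covariance over
    the deformed Hopf algebra is [deform_codiagonal]: the right-hand factor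
    [gam'] of the deformed product cancels the twist of the map.

    On forms, [delbar] and the product of (0,1)-forms are defined by taking
    components; they are colinear because the component maps extend to colinear
    projections of the whole of Omega ([bipart], [bipart_colinear]).  As the
    inclusions of the graded pieces do not change under deformation, the deformed
    [delbar] is the same map and the deformed product is the twist of the old one
    ([deform_wedge01]).

    The Leibniz rule and the vanishing of the curvature are then checked after
    applying the injective map [phi].  For the Leibniz rule this gives the twist
    of the original rule.  For the curvature, [phi] intertwines the two operators
    [delbar (x) id - id /\ delbar_E] ([phi_delbar_twisted]), hence sends the new
    curvature to the old one, which is zero. *)

Set Implicit Arguments.
Unset Strict Implicit.
Unset Printing Implicit Defensive.

Import GRing.Theory.
Local Open Scope ring_scope.

(** * Multilinear maps and Sweedler sums *)

Section Multilinear.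
Variable K : comNzRingType.
Implicit Types U V W Z : lmodType K.

(** Linearity of bare functions: the maps below are lambda terms with no bundled
    linear structure, and keeping [lin] folded lets [multilin] recognise its
    goals. *)
Definition lin V W (f : V -> W) :=
  forall c u v, f (c *: u + v) = c *: f u + f v.
Definition bilin U V W (f : U -> V -> W) :=
  (forall v, lin (f^~ v)) /\ (forall u, lin (f u)).
Definition trilin U V W Z (f : U -> V -> W -> Z) :=
  (forall v w, lin (fun u => f u v w)) /\ (forall u, bilin (f u)).

Lemma lin0 V W (f : V -> W) : lin f -> f 0 = 0.
Proof. by move=> fl; have := fl (-1) 0 0; rewrite !scaleN1r oppr0 addr0 addNr. Qed.

Lemma linD V W (f : V -> W) : lin f -> {morph f : u v / u + v}.
Proof. by move=> fl u v; have := fl 1 u v; rewrite !scale1r. Qed.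

Lemma linZ V W (f : V -> W) : lin f -> forall c u, f (c *: u) = c *: f u.
Proof. by move=> fl c u; have := fl c u 0; rewrite (lin0 fl) !addr0. Qed.

Lemma linB V W (f : V -> W) : lin f -> {morph f : u v / u - v}.
Proof. by move=> fl u v; rewrite linD // -scaleN1r linZ // scaleN1r. Qed.

Lemma lin_sum V W (f : V -> W) I (r : seq I) (P : pred I) F : lin f ->
  f (\sum_(i <- r | P i) F i) = \sum_(i <- r | P i) f (F i).
Proof. by move=> fl; apply: (big_morph f (linD fl) (lin0 fl)). Qed.

Lemma lin_id V : lin (fun x : V => x). Proof. by []. Qed.

Lemma lin_comp U V W (g : V -> W) (f : U -> V) :
  lin g -> lin f -> lin (fun x => g (f x)).
Proof. by move=> gl fl c u v; rewrite fl gl. Qed.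

Lemma lin_scaler V W c (f : V -> W) : lin f -> lin (fun x => c *: f x).
Proof. by move=> fl d u v; rewrite fl scalerDr !scalerA mulrC. Qed.

Lemma lin_scalel V W (f : V -> K^o) (z : W) : lin f -> lin (fun x => f x *: z).
Proof. by move=> fl d u v; rewrite fl scalerDl scalerA. Qed.

Lemma lin_mull V (f : V -> K^o) (z : K^o) :
  lin f -> lin (fun x => f x * z : K^o).
Proof. by move=> fl d u v; rewrite fl mulrDl -scalerAl. Qed.

Lemma lin_mulr V (f : V -> K^o) (z : K^o) :
  lin f -> lin (fun x => z * f x : K^o).
Proof. by move=> fl d u v; rewrite fl mulrDr -scalerAr. Qed.

Lemma lin_sub V W (f g : V -> W) : lin f -> lin g -> lin (fun x => f x - g x).
Proof. by move=> fl gl d u v; rewrite fl gl scalerBr opprD addrACA. Qed.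

Section Tens.
Variables (M N : lmodType K) (B : Type) (ra : M -> B -> M) (la : B -> N -> N).
Local Notation T := (tens ra la).

Lemma lin_tpurel n : lin (fun m => tpure m n : T).
Proof. by move=> c u v; rewrite tpureDl tpureZl. Qed.

Lemma eq_tlift (Z : zmodType) (f g : M -> N -> Z) (t : T) :
  (forall x y, f x y = g x y) -> tlift f t = tlift g t.
Proof. by move=> fg; apply: eq_bigr => p _; apply: fg. Qed.

(** [tlift] is a finite sum over a chosen representative of [t], so a linear map can
    be moved inside for an arbitrary [f]; balancedness of [f] matters only for the
    dependence on [t], see [lin_tliftB]. *)
Lemma tlift_sum Z Z' (L : Z -> Z') (f : M -> N -> Z) (t : T) : lin L ->
  L (tlift f t) = tlift (fun x y => L (f x y)) t.
Proof. by move=> Ll; apply: lin_sum. Qed.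

Lemma tlift_tpure (t : T) : tlift (fun x y => tpure x y : T) t = t.
Proof. by rewrite {2}(tens_sum t). Qed.

Lemma lin_tlift V Z (f : V -> M -> N -> Z) (t : T) :
  (forall x y, lin (fun v => f v x y)) -> lin (fun v => tlift (f v) t).
Proof.
move=> fl c u v; rewrite /tlift scaler_sumr -big_split /=.
by apply: eq_bigr => p _; rewrite fl.
Qed.

Variables (Z : lmodType K) (f : M -> N -> Z).
Hypotheses (fl : bilin f) (fbal : forall m b n, f (ra m b) n = f m (la b n)).

Let fDl m m' n : f (m + m') n = f m n + f m' n.
Proof. exact: (linD (fl.1 n)). Qed.
Let fDr m n n' : f m (n + n') = f m n + f m n'.
Proof. exact: (linD (fl.2 m)). Qed.
Let fZl c m n : f (c *: m) n = c *: f m n.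
Proof. exact: (linZ (fl.1 n)). Qed.

Lemma lin_tliftB : lin (fun t : T => tlift f t).
Proof.
have pE := @tlift_pi _ _ _ _ ra la Z idfun f fDl fDr fZl fbal.
move=> c; elim/tens_ind=> s; elim/tens_ind=> t.
rewrite -[_ *: _]/(tscale _ _) tscale_pi -[_ + _]/(tadd _ _) tadd_pi !pE.
rewrite big_cat /= big_map scaler_sumr; congr (_ + _).
by apply: eq_bigr => p _ /=; rewrite fZl.
Qed.

Lemma tliftB_pure m n : tlift f (tpure m n : T) = f m n.
Proof.
have pE := @tlift_pi _ _ _ _ ra la Z idfun f fDl fDr fZl fbal.
by rewrite pE big_seq1.
Qed.

End Tens.

Lemma tlift_exch (M N M' N' : lmodType K) (B B' : Type)
    (ra : M -> B -> M) la (ra' : M' -> B' -> M') (la' : B' -> N' -> N')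
    (Z : zmodType) (f : M -> N -> M' -> N' -> Z) (t : tens ra la)
    (t' : tens ra' la') :
  tlift (fun x y => tlift (fun x' y' => f x y x' y') t') t =
  tlift (fun x' y' => tlift (fun x y => f x y x' y') t) t'.
Proof. exact: exchange_big. Qed.

(* Over K itself, balancedness is part of bilinearity. *)
Section TensC.
Variables (M N Z : lmodType K) (f : M -> N -> Z).
Hypothesis fl : bilin f.

Let fbal (m : M) (b : K) (n : N) : f (b *: m) n = f m (b *: n).
Proof. by rewrite (linZ (fl.2 m)) -(linZ (fl.1 n)). Qed.

Lemma tliftC_lin : lin (fun t : tensC M N => tlift f t).
Proof. exact: lin_tliftB. Qed.

Lemma tlift_ox m n : tlift f (m \ox n) = f m n.
Proof. exact: tliftB_pure. Qed.
End TensC.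

Lemma bilin_ox (M N : lmodType K) : bilin (@tpureC K M N).
Proof.
split=> [n|m] c u v; first exact: lin_tpurel.
by rewrite /tpureC tpureDr -tpure_bal tpureZl.
Qed.

Lemma tlift_id (M N : lmodType K) (t : tensC M N) :
  tlift (fun x y => x \ox y) t = t.
Proof. exact: tlift_tpure. Qed.

End Multilinear.

Lemma lin_tliftC (K : comNzRingType) (U M N Z : lmodType K) (f : M -> N -> Z)
    (h : U -> tensC M N) :
  bilin f -> lin h -> lin (fun u => tlift f (h u)).
Proof. by move=> fl hl; apply: lin_comp (tliftC_lin fl) hl. Qed.

Lemma lin_oxl (K : comNzRingType) (U M N : lmodType K) (f : U -> M) (n : N) :
  lin f -> lin (fun u => f u \ox n).
Proof. exact: lin_comp ((bilin_ox M N).1 n). Qed.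

Lemma lin_oxr (K : comNzRingType) (U M N : lmodType K) (f : U -> N) (m : M) :
  lin f -> lin (fun u => m \ox f u).
Proof. exact: lin_comp ((bilin_ox M N).2 m). Qed.

Lemma bilin_compl (K : comNzRingType) (U V W Z : lmodType K)
    (k : V -> W -> Z) (f : U -> V) w :
  bilin k -> lin f -> lin (fun u => k (f u) w).
Proof. by move=> kl; apply: lin_comp (kl.1 w). Qed.

Lemma bilin_compr (K : comNzRingType) (U V W Z : lmodType K)
    (k : W -> V -> Z) (f : U -> V) w :
  bilin k -> lin f -> lin (fun u => k w (f u)).
Proof. by move=> kl; apply: lin_comp (kl.2 w). Qed.

Lemma trilin_comp1 (K : comNzRingType) (X U V W Z : lmodType K)
    (k : U -> V -> W -> Z) (f : X -> U) v w :
  trilin k -> lin f -> lin (fun x => k (f x) v w).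
Proof. by move=> kl; apply: lin_comp (kl.1 v w). Qed.

Lemma trilin_comp2 (K : comNzRingType) (X U V W Z : lmodType K)
    (k : U -> V -> W -> Z) (f : X -> V) u w :
  trilin k -> lin f -> lin (fun x => k u (f x) w).
Proof. by move=> kl; apply: lin_comp ((kl.2 u).1 w). Qed.

Lemma trilin_comp3 (K : comNzRingType) (X U V W Z : lmodType K)
    (k : U -> V -> W -> Z) (f : X -> W) u v :
  trilin k -> lin f -> lin (fun x => k u v (f x)).
Proof. by move=> kl; apply: lin_comp ((kl.2 u).2 v). Qed.

(** Proves linearity in one variable of a nested Sweedler sum, by descending to
    the only factor in which the variable occurs.  Linearity of the maps involved
    is read off the context, where section-local [Let]s put it. *)
Ltac multilin_step :=
  match goal with
  | |- forall _, _ => intro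
  | |- _ /\ _ => split
  | |- bilin _ => split
  | |- trilin _ => split
  | |- lin (fun x => x) => apply: lin_id
  | H : lin ?f |- lin ?f => exact: H
  | |- lin (fun x => tlift (fun a b => @?F a b x) ?t) =>
      refine (@lin_tlift _ _ _ _ _ _ _ _ (fun x a b => F a b x) t _)
  | |- lin (fun x => tlift ?f _) => apply: lin_tliftC
  | |- lin (fun x => tpureC _ ?n) => apply: lin_oxl
  | |- lin (fun x => tpureC ?m _) => apply: lin_oxr
  | |- lin (fun x => _ - _) => apply: lin_sub
  | |- lin (fun x => ?c *: _) => apply: lin_scaler
  | |- lin (fun x => _ *: ?c) => apply: lin_scalel
  | |- lin (fun x => ?c * _) => apply: lin_mulr
  | |- lin (fun x => _ * ?c) => apply: lin_mull
  | H : bilin ?k |- lin (fun x => ?k _ ?w) => apply: (bilin_compl _ H)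
  | H : bilin ?k |- lin (fun x => ?k ?w _) => apply: (bilin_compr _ H)
  | H : lin ?f |- lin (fun x => ?f _) => apply: (lin_comp H)
  | H : trilin ?k |- lin (fun x => ?k _ ?v ?w) => apply: (trilin_comp1 _ _ H)
  | H : trilin ?k |- lin (fun x => ?k ?u _ ?w) => apply: (trilin_comp2 _ _ H)
  | H : trilin ?k |- lin (fun x => ?k ?u ?v _) => apply: (trilin_comp3 _ _ H)
  | |- lin (fun x => ?h (tpureC _ _)) =>
      apply: (@lin_comp _ _ _ _ h); [by move=> ? ? ?; rewrite linearP|]
  | H : bilin ?k |- lin (?k ?u) => exact: H.2 u
  | H : trilin ?k |- lin (?k ?u ?v) => exact: (H.2 u).2 v
  | |- lin (tpureC ?m) => exact: (bilin_ox _ _).2 m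
  end; cbv beta.
Ltac multilin := repeat multilin_step.

(** * Twisting bilinear maps between comodules *)

Section Twist.
Variables (R : realType) (A : hopf R).
Local Notation C := R[i].
Implicit Types U V W Z : lmodType C.
Hypothesis bialgA : is_bialgebra A.

Lemma comodule_lin V (co : V -> tensC A V) : is_comodule co -> lin co.
Proof. by case. Qed.

Lemma cop_comodule : is_comodule (@cop R A).
Proof. by case: bialgA => _ []. Qed.

Lemma amul_bilin : bilin (@amul R A).
Proof.
by case: bialgA => -[ml mr _ _ _] _ _ _ _; split=> *; [exact: mr|exact: ml].
Qed.

(** Coassociativity in the form in which Sweedler calculations use it: the two
    sides are the images, under the map induced by the trilinear [f], of the two
    sides of the comodule axiom. *)
Lemma coassoc V Z (co : V -> tensC A V) (f : A -> A -> V -> Z) v :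
  is_comodule co -> trilin f ->
  \Sw_(a, w <- co v) \Sw_(b, u <- co w) f a b u =
  \Sw_(a, w <- co v) \Sw_(a1, a2 <- cop a) f a1 a2 w.
Proof.
move=> [_ coA _] fl; pose L := fun t : tensC A (tensC A V) =>
  \Sw_(a, s <- t) \Sw_(b, u <- s) f a b u.
have fal a : bilin (f a) := fl.2 a.
have gl : bilin (fun a (s : tensC A V) => \Sw_(b, u <- s) f a b u) by multilin.
have Ll : lin L by apply: tliftC_lin.
have /(congr1 L) := coA v; rewrite !(tlift_sum _ _ Ll) => e.
have Lox a b u : L (a \ox (b \ox u)) = f a b u.
  by rewrite /L (tlift_ox gl) (tlift_ox (fal a)).
transitivity (\Sw_(a, w <- co v) L (\Sw_(b, u <- co w) a \ox (b \ox u))).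
  by apply: eq_tlift => a w; rewrite (tlift_sum _ _ Ll); apply: eq_tlift => b u.
rewrite -e; apply: eq_tlift => a w.
by rewrite (tlift_sum _ _ Ll); apply: eq_tlift.
Qed.

Lemma counit V Z (co : V -> tensC A V) (f : V -> Z) v :
  is_comodule co -> lin f -> \Sw_(a, w <- co v) cou a *: f w = f v.
Proof.
move=> [_ _ co1] fl; rewrite -{2}[v]co1 (tlift_sum _ _ fl).
by apply: eq_tlift => a w; rewrite (linZ fl).
Qed.

Lemma coassoc2 V W Z (cv : V -> tensC A V) (cw : W -> tensC A W)
    (f : A -> A -> A -> A -> V -> W -> Z) v w :
  is_comodule cv -> is_comodule cw ->
  (forall y y' w, trilin (fun x x' v => f x y x' y' v w)) ->
  (forall x x' v, trilin (fun y y' w => f x y x' y' v w)) ->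
  \Sw_(x, v0 <- cv v) \Sw_(y, w0 <- cw w)
    \Sw_(x', v1 <- cv v0) \Sw_(y', w1 <- cw w0) f x y x' y' v1 w1 =
  \Sw_(x, v0 <- cv v) \Sw_(y, w0 <- cw w)
    \Sw_(x1, x2 <- cop x) \Sw_(y1, y2 <- cop y) f x1 y1 x2 y2 v0 w0.
Proof.
move=> cvP cwP f1 f2.
transitivity (\Sw_(x, v0 <- cv v) \Sw_(x', v1 <- cv v0)
  \Sw_(y, w0 <- cw w) \Sw_(y', w1 <- cw w0) f x y x' y' v1 w1).
  by apply: eq_tlift => x v0; rewrite tlift_exch.
rewrite (@coassoc _ _ _ (fun x x' v1 => \Sw_(y, w0 <- cw w)
  \Sw_(y', w1 <- cw w0) f x y x' y' v1 w1)) //; last first.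
  split=> [x' v'|x]; last split=> [v'|x'].
  - by do 2!(apply: lin_tlift => ? ?); apply: (f1 _ _ _).1.
  - by do 2!(apply: lin_tlift => ? ?); apply: ((f1 _ _ _).2 _).1.
  - by do 2!(apply: lin_tlift => ? ?); apply: ((f1 _ _ _).2 _).2.
apply: eq_tlift => x v0.
rewrite [RHS]tlift_exch; apply: eq_tlift => x1 x2.
exact: coassoc (f2 x1 x2 v0).
Qed.

(** The deformation of [k] by a bilinear form [F] on [A]. *)
Definition twist V W Z (cv : V -> tensC A V) (cw : W -> tensC A W)
    (F : A -> A -> C) (k : V -> W -> Z) (v : V) (w : W) : Z :=
  \Sw_(x, v0 <- cv v) \Sw_(y, w0 <- cw w) F x y *: k v0 w0.

Definition twist3 U V W Z (cu : U -> tensC A U) (cv : V -> tensC A V)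
    (cw : W -> tensC A W) (F : A -> A -> A -> C) (k : U -> V -> W -> Z)
    (u : U) (v : V) (w : W) : Z :=
  \Sw_(x, u0 <- cu u) \Sw_(y, v0 <- cv v) \Sw_(z, w0 <- cw w)
    F x y z *: k u0 v0 w0.

Local Notation biform F := (bilin (F : A -> A -> C^o)).
Local Notation triform F := (trilin (F : A -> A -> A -> C^o)).

Lemma twist_bilin V W Z cv cw F k :
  lin cv -> lin cw -> biform F -> bilin k -> bilin (@twist V W Z cv cw F k).
Proof. by move=> ? ? ? ?; rewrite /twist; multilin. Qed.

Lemma twist3_trilin U V W Z cu cv cw F k :
  lin cu -> lin cv -> lin cw -> triform F -> trilin k ->
  trilin (@twist3 U V W Z cu cv cw F k).
Proof. by move=> ? ? ? ? ?; rewrite /twist3; multilin. Qed.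

Lemma eq_twist V W Z cv cw F F' k k' v w :
  (forall x y, F x y = F' x y) -> (forall v w, k v w = k' v w) ->
  @twist V W Z cv cw F k v w = twist cv cw F' k' v w.
Proof. by move=> FF kk; do 2!(apply: eq_tlift => ? ?); rewrite FF kk. Qed.

Lemma eq_twist3 U V W Z cu cv cw F F' k k' u v w :
  (forall x y z, F x y z = F' x y z) ->
  (forall u v w, k u v w = k' u v w) ->
  @twist3 U V W Z cu cv cw F k u v w = twist3 cu cv cw F' k' u v w.
Proof. by move=> FF kk; do 3!(apply: eq_tlift => ? ?); rewrite FF kk. Qed.

Lemma twistD V W Z cv cw F (k l : V -> W -> Z) v w :
  twist cv cw F (fun v w => k v w + l v w) v w =
  twist cv cw F k v w + twist cv cw F l v w.
Proof.
rewrite /twist /tlift -big_split; apply: eq_bigr => p _.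
by rewrite -big_split; apply: eq_bigr => r _; rewrite /= scalerDr.
Qed.

Lemma twistB V W Z cv cw F (k l : V -> W -> Z) v w :
  twist cv cw F (fun v w => k v w - l v w) v w =
  twist cv cw F k v w - twist cv cw F l v w.
Proof.
rewrite /twist /tlift -sumrB; apply: eq_bigr => p _.
by rewrite -sumrB; apply: eq_bigr => r _; rewrite scalerBr.
Qed.

Lemma twist_post V W Z Z' (L : Z -> Z') cv cw F k v w : lin L ->
  L (@twist V W Z cv cw F k v w) = twist cv cw F (fun v w => L (k v w)) v w.
Proof.
move=> Ll; rewrite /twist (tlift_sum _ _ Ll); apply: eq_tlift => x v0.
by rewrite (tlift_sum _ _ Ll); apply: eq_tlift => y w0; rewrite (linZ Ll).
Qed.

(** The convolution product of the dual of the coalgebra A (x) A. *)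
Definition conv (F G : A -> A -> C) (x y : A) : C :=
  \Sw_(x1, x2 <- cop x) \Sw_(y1, y2 <- cop y) (F x1 y1 * G x2 y2 : C).

(** Twisting is an action of the convolution algebra: the coactions of [V] and [W]
    make the bilinear maps on V x W a module over it. *)
Lemma twist_twist V W Z cv cw F G (k : V -> W -> Z) v w :
  is_comodule cv -> is_comodule cw -> biform F -> biform G -> bilin k ->
  twist cv cw F (twist cv cw G k) v w = twist cv cw (conv F G) k v w.
Proof.
move=> cvP cwP Fl Gl kl.
pose f x y x' y' v w := (F x y * G x' y' : C) *: k v w.
transitivity (\Sw_(x, v0 <- cv v) \Sw_(y, w0 <- cw w)
    \Sw_(x', v1 <- cv v0) \Sw_(y', w1 <- cw w0) f x y x' y' v1 w1).
  do 2!(apply: eq_tlift => ? ?).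
  rewrite (twist_post _ _ _ _ _ _ (lin_scaler _ (@lin_id _ _))).
  by do 2!(apply: eq_tlift => ? ?); rewrite scalerA mulrC.
rewrite coassoc2 //; rewrite /f; multilin.
do 2!(apply: eq_tlift => ? ?); rewrite /conv.
rewrite (@tlift_sum _ _ _ _ _ _ C^o _ (fun c => c *: _)); last by multilin.
apply: eq_tlift => ? ?.
by rewrite (@tlift_sum _ _ _ _ _ _ C^o _ (fun c => c *: _)); last by multilin.
Qed.

Lemma twist_cou V W Z cv cw (k : V -> W -> Z) v w :
  is_comodule cv -> is_comodule cw -> bilin k ->
  twist cv cw (fun x y => cou x * cou y) k v w = k v w.
Proof.
move=> cvP cwP kl.
rewrite -[RHS](counit _ cvP (kl.1 w)); apply: eq_tlift => x v0.
rewrite -(counit w cwP (kl.2 v0)).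
rewrite (tlift_sum _ _ (lin_scaler _ (@lin_id _ _))).
by apply: eq_tlift => y w0; rewrite scalerA.
Qed.

Section Three.
Variables (U V W Z : lmodType C) (cu : U -> tensC A U) (cv : V -> tensC A V)
  (cw : W -> tensC A W).
Hypotheses (cuP : is_comodule cu) (cvP : is_comodule cv)
  (cwP : is_comodule cw).
Implicit Type k : U -> V -> W -> Z.

Let cul : lin cu := comodule_lin cuP.
Let cvl : lin cv := comodule_lin cvP.
Let cwl : lin cw := comodule_lin cwP.

Lemma twist3_outl F k u v w : twist3 cu cv cw F k u v w =
  \Sw_(x, u0 <- cu u) twist cv cw (F x) (k u0) v w.
Proof. by []. Qed.

Lemma twist3_outr F k u v w : twist3 cu cv cw F k u v w =
  \Sw_(z, w0 <- cw w) twist cu cv (fun x y => F x y z) (fun u v => k u v w0) u v.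
Proof.
rewrite /twist3 /twist [RHS]tlift_exch; apply: eq_tlift => x u0.
by rewrite tlift_exch.
Qed.

Lemma twist_suml V' W' (I J Z' : lmodType C) (cv' : V' -> tensC A V')
    (cw' : W' -> tensC A W') F (t : tensC I J) (k : I -> J -> V' -> W' -> Z') v w :
  twist cv' cw' F (fun v w => \Sw_(i, j <- t) k i j v w) v w =
  \Sw_(i, j <- t) twist cv' cw' F (k i j) v w.
Proof.
rewrite [RHS]tlift_exch; apply: eq_tlift => x v0.
rewrite [RHS]tlift_exch; apply: eq_tlift => y w0.
by rewrite (tlift_sum _ _ (lin_scaler _ (@lin_id _ _))).
Qed.

Lemma twist_23 F G k u v w : biform F -> triform G -> trilin k ->
  twist cv cw F (twist3 cu cv cw G k u) v w =
  twist3 cu cv cw (fun x => conv F (G x)) k u v w.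
Proof.
move=> Fl Gl kl; rewrite twist3_outl.
rewrite (twist_suml _ _ _ (cu u) (fun x u0 => twist cv cw (G x) (k u0))).
by apply: eq_tlift => x u0; apply: twist_twist => //; [exact: Gl.2|exact: kl.2].
Qed.

Lemma trilin_fix3 (U' V' W' Z' : lmodType C) (k : U' -> V' -> W' -> Z') w :
  trilin k -> bilin (fun u v => k u v w).
Proof. by move=> kl; multilin. Qed.

Lemma twist_12 F G k u v w : biform F -> triform G -> trilin k ->
  twist cu cv F (fun u v => twist3 cu cv cw G k u v w) u v =
  twist3 cu cv cw (fun x y z => conv F (fun x y => G x y z) x y) k u v w.
Proof.
move=> Fl Gl kl; rewrite twist3_outr.
transitivity (twist cu cv F (fun u v => \Sw_(z, w0 <- cw w)
   twist cu cv (fun x y => G x y z) (fun u v => k u v w0) u v) u v).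
  by apply: eq_twist => // *; exact: twist3_outr.
rewrite (twist_suml _ _ _ (cw w)
  (fun z w0 => twist cu cv (fun x y => G x y z) (fun u v => k u v w0))).
apply: eq_tlift => z w0; apply: twist_twist => //; first exact: (trilin_fix3 _ Gl).
exact: trilin_fix3.
Qed.

Definition conv3 (F G : A -> A -> A -> C) x y z : C :=
  \Sw_(x1, x2 <- cop x) \Sw_(y1, y2 <- cop y) \Sw_(z1, z2 <- cop z)
    (F x1 y1 z1 * G x2 y2 z2 : C).

(** The analogue of [twist_twist] for A (x) A (x) A: coassociativity is used on [u]
    first, with the sums over [v] and [w] as spectators, then on [v] and [w]. *)
Lemma twist3_twist3 F G k u v w : triform F -> triform G -> trilin k ->
  twist3 cu cv cw F (twist3 cu cv cw G k) u v w =
  twist3 cu cv cw (conv3 F G) k u v w.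
Proof.
move=> Fl Gl kl.
pose f x y z x' y' z' u v w := (F x y z * G x' y' z' : C) *: k u v w.
transitivity (\Sw_(x, u0 <- cu u) \Sw_(x', u1 <- cu u0)
  \Sw_(y, v0 <- cv v) \Sw_(z, w0 <- cw w)
  \Sw_(y', v1 <- cv v0) \Sw_(z', w1 <- cw w0) f x y z x' y' z' u1 v1 w1).
  apply: eq_tlift => x u0.
  transitivity (\Sw_(y, v0 <- cv v) \Sw_(z, w0 <- cw w) \Sw_(x', u1 <- cu u0)
    \Sw_(y', v1 <- cv v0) \Sw_(z', w1 <- cw w0) f x y z x' y' z' u1 v1 w1).
    do 2!(apply: eq_tlift => ? ?); rewrite /twist3.
    do 3!(rewrite (tlift_sum _ _ (lin_scaler _ (@lin_id _ _)));
          apply: eq_tlift => ? ?).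
    by rewrite scalerA.
  by rewrite [RHS]tlift_exch; apply: eq_tlift => y v0; rewrite tlift_exch.
rewrite (@coassoc _ _ _ (fun x x' u1 => \Sw_(y, v0 <- cv v) \Sw_(z, w0 <- cw w)
  \Sw_(y', v1 <- cv v0) \Sw_(z', w1 <- cw w0) f x y z x' y' z' u1 v1 w1)) //.
  2: by rewrite /f; multilin.
apply: eq_tlift => x u0.
transitivity (\Sw_(x1, x2 <- cop x) \Sw_(y, v0 <- cv v) \Sw_(z, w0 <- cw w)
  \Sw_(y1, y2 <- cop y) \Sw_(z1, z2 <- cop z) f x1 y1 z1 x2 y2 z2 u0 v0 w0).
  apply: eq_tlift => x1 x2.
  by apply: coassoc2 => //; rewrite /f; multilin.
rewrite tlift_exch; apply: eq_tlift => y v0.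
rewrite tlift_exch; apply: eq_tlift => z w0.
rewrite /conv3 (@tlift_sum _ _ _ _ _ _ C^o _ (fun c => c *: _)); last by multilin.
apply: eq_tlift => ? ?.
rewrite (@tlift_sum _ _ _ _ _ _ C^o _ (fun c => c *: _)); last by multilin.
apply: eq_tlift => ? ?.
by rewrite (@tlift_sum _ _ _ _ _ _ C^o _ (fun c => c *: _)); last by multilin.
Qed.

Lemma twist3_cou k u v w : trilin k ->
  twist3 cu cv cw (fun x y z => cou x * cou y * cou z) k u v w = k u v w.
Proof.
move=> kl; rewrite -[RHS](counit _ cuP (kl.1 v w)); apply: eq_tlift => x u0.
rewrite -(twist_cou v w cvP cwP (kl.2 u0)).
rewrite (@twist_post _ _ _ _ (fun z => _ *: z)) => [|]; last by multilin.
do 2!(apply: eq_tlift => ? ?); rewrite scalerA.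
by rewrite -mulrA mulrC.
Qed.

End Three.

Definition colinear V W (cv : V -> tensC A V) (cw : W -> tensC A W)
    (f : V -> W) :=
  forall v, cw (f v) = \Sw_(x, v0 <- cv v) x \ox f v0.

(** [mu] is a comodule map for the codiagonal coaction
    v (x) w |-> v_(-1) w_(-1) (x) (v_0 (x) w_0). *)
Definition codiagonal U V W (cu : U -> tensC A U) (cv : V -> tensC A V)
    (cw : W -> tensC A W) (mu : U -> V -> W) :=
  forall u v, cw (mu u v) =
    \Sw_(x, u0 <- cu u) \Sw_(y, v0 <- cv v) amul x y \ox mu u0 v0.

Section Pull.
Variables (U V W X Z : lmodType C) (cu : U -> tensC A U) (cv : V -> tensC A V)
  (cw : W -> tensC A W) (cx : X -> tensC A X).

Lemma tlift_colinear (f : U -> X) (h : A -> X -> Z) u :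
  colinear cu cx f -> bilin h ->
  \Sw_(x, z <- cx (f u)) h x z = \Sw_(x, u0 <- cu u) h x (f u0).
Proof.
move=> fP hl; rewrite fP (tlift_sum _ _ (tliftC_lin hl)).
by apply: eq_tlift => x u0; rewrite (tlift_ox hl).
Qed.

Lemma tlift_codiagonal (mu : U -> V -> X) (h : A -> X -> Z) u v :
  codiagonal cu cv cx mu -> bilin h ->
  \Sw_(x, z <- cx (mu u v)) h x z =
  \Sw_(x, u0 <- cu u) \Sw_(y, v0 <- cv v) h (amul x y) (mu u0 v0).
Proof.
move=> muP hl; rewrite muP (tlift_sum _ _ (tliftC_lin hl)).
apply: eq_tlift => x u0; rewrite (tlift_sum _ _ (tliftC_lin hl)).
by apply: eq_tlift => y v0; rewrite (tlift_ox hl).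
Qed.

Lemma twist_colinearl F (k : X -> W -> Z) (f : U -> X) u w :
  colinear cu cx f -> biform F -> bilin k ->
  twist cx cw F k (f u) w = twist cu cw F (fun u w => k (f u) w) u w.
Proof.
move=> fP Fl kl.
rewrite /twist (tlift_colinear (h := fun x x0 =>
  \Sw_(y, w0 <- cw w) F x y *: k x0 w0)) //.
by multilin.
Qed.

Lemma twist_colinearr F (k : W -> X -> Z) (f : U -> X) u w :
  colinear cu cx f -> biform F -> bilin k ->
  twist cw cx F k w (f u) = twist cw cu F (fun w u => k w (f u)) w u.
Proof.
move=> fP Fl kl; apply: eq_tlift => y w0.
by rewrite (tlift_colinear (h := fun x x0 => F y x *: k w0 x0)); last by multilin.
Qed.

(** A codiagonal map turns the argument [F(s, z)] into [F(x y, z)], which is how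
    the product of [A] enters the cocycle identity. *)
Lemma twist_codiagonall F (k : X -> W -> Z) (mu : U -> V -> X) u v w :
  codiagonal cu cv cx mu -> biform F -> bilin k ->
  twist cx cw F k (mu u v) w =
  twist3 cu cv cw (fun x y z => F (amul x y) z) (fun u v w => k (mu u v) w) u v w.
Proof.
move=> muP Fl kl.
rewrite /twist (tlift_codiagonal (h := fun x x0 =>
  \Sw_(y, w0 <- cw w) F x y *: k x0 w0)) //.
by multilin.
Qed.

Lemma twist_codiagonalr F (k : W -> X -> Z) (mu : U -> V -> X) w u v :
  codiagonal cu cv cx mu -> biform F -> bilin k ->
  twist cw cx F k w (mu u v) =
  twist3 cw cu cv (fun x y z => F x (amul y z)) (fun w u v => k w (mu u v)) w u v.
Proof.
move=> muP Fl kl; apply: eq_tlift => y w0.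
by rewrite (tlift_codiagonal (h := fun x x0 => F y x *: k w0 x0)); last by multilin.
Qed.

End Pull.

Section Cocycle.
Variables g gb : {scalar tensC A A}.
Hypothesis gP : is_2cocycle g gb.

Local Notation gf := (fun x y : A => g (x \ox y) : C).
Local Notation gbf := (fun x y : A => gb (x \ox y) : C).

Lemma scalar_biform (h : {scalar tensC A A}) : biform (fun x y => h (x \ox y)).
Proof.
have hl : lin (h : _ -> C^o) by move=> c u v; rewrite linearP.
by split=> ?; apply: lin_comp hl _; multilin.
Qed.
Let gl : biform gf := scalar_biform g.
Let gbl : biform gbf := scalar_biform gb.

Lemma biform_triforml F : biform F -> triform (fun x y z => F (amul x y) z).
Proof. by move=> Fl; have ml := amul_bilin; multilin. Qed.
Lemma biform_triformr F : biform F -> triform (fun x y z => F x (amul y z)).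
Proof. by move=> Fl; have ml := amul_bilin; multilin. Qed.

Lemma conv_gb_g x y : conv gbf gf x y = cou x * cou y.
Proof. by case: gP => -[_ gbg] _ _; exact: gbg. Qed.
Lemma conv_g_gb x y : conv gf gbf x y = cou x * cou y.
Proof. by case: gP => -[ggb _] _ _; exact: ggb. Qed.
Lemma cocycleE x y z : conv gf (fun x y => gf (amul x y) z) x y =
  conv gf (fun y z => gf x (amul y z)) y z.
Proof. by case: gP => _ coc _; exact: coc. Qed.

Lemma couM (x y : A) : cou (amul x y) = cou x * cou y.
Proof. by case: bialgA => _ _ _ _ []. Qed.

Lemma cop_codiagonal : codiagonal (@cop R A) (@cop R A) (@cop R A) (@amul R A).
Proof. by case: bialgA. Qed.

Section Inverse.
Variables F G : A -> A -> C.
Hypotheses (Fl : biform F) (Gl : biform G).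
Hypothesis FG : forall x y, conv F G x y = cou x * cou y.

(** Since the coproduct is multiplicative, [F |-> F(x y, z)] is a morphism of
    convolution algebras, so it preserves inverses. *)
Lemma conv3_mull x y z :
  conv3 (fun x y z => F (amul x y) z) (fun x y z => G (amul x y) z) x y z =
  cou x * cou y * cou z.
Proof.
rewrite -couM -FG /conv.
rewrite (tlift_codiagonal (Z := C^o) (h := fun s1 s2 => \Sw_(z1, z2 <- cop z)
   (F s1 z1 * G s2 z2 : C)) _ _ cop_codiagonal) //.
by multilin.
Qed.

Lemma conv3_mulr x y z :
  conv3 (fun x y z => F x (amul y z)) (fun x y z => G x (amul y z)) x y z =
  cou x * cou y * cou z.
Proof.
rewrite -mulrA -couM -FG /conv; apply: eq_tlift => x1 x2.
rewrite (tlift_codiagonal (Z := C^o) (h := fun s1 s2 =>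
   (F x1 s1 * G x2 s2 : C)) _ _ cop_codiagonal) //.
by multilin.
Qed.
End Inverse.

Section Assoc.
Variables (U V W Z : lmodType C) (cu : U -> tensC A U) (cv : V -> tensC A V)
  (cw : W -> tensC A W).
Hypotheses (cuP : is_comodule cu) (cvP : is_comodule cv)
  (cwP : is_comodule cw).
Implicit Type k : U -> V -> W -> Z.

Let cul : lin cu := comodule_lin cuP.
Let cvl : lin cv := comodule_lin cvP.
Let cwl : lin cw := comodule_lin cwP.

(** The four operators on trilinear maps out of which both sides of the cocycle
    identity are composed: [twist12 g] and [twist23 g] act by [gam(x, y)] and
    [gam(y, z)], [twistl g] and [twistr g] by [gam(x y, z)] and [gam(x, y z)]. *)
Definition twist12 F k u v w := twist cu cv F (fun u v => k u v w) u v.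
Definition twist23 F k u v w := twist cv cw F (k u) v w.
Definition twistl F := @twist3 _ _ _ Z cu cv cw (fun x y z => F (amul x y) z).
Definition twistr F := @twist3 _ _ _ Z cu cv cw (fun x y z => F x (amul y z)).

Lemma twist23_trilin F k : biform F -> trilin k -> trilin (twist23 F k).
Proof. by move=> Fl kl; rewrite /twist23 /twist; multilin. Qed.
Lemma twistl_trilin F k : biform F -> trilin k -> trilin (twistl F k).
Proof. by move=> Fl kl; apply: twist3_trilin => //; exact: biform_triforml. Qed.
Lemma twistr_trilin F k : biform F -> trilin k -> trilin (twistr F k).
Proof. by move=> Fl kl; apply: twist3_trilin => //; exact: biform_triformr. Qed.

Lemma twist_cocycle k u v w : trilin k ->
  twist12 gf (twistl gf k) u v w = twist23 gf (twistr gf k) u v w.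
Proof.
move=> kl; rewrite /twist12 /twist23 /twistl /twistr.
rewrite twist_12 ?twist_23 //; last 2 first.
- exact: biform_triformr gl.
- exact: biform_triforml gl.
by apply: eq_twist3 => // x y z; rewrite cocycleE.
Qed.

Section OpInverse.
Variables F G : A -> A -> C.
Hypotheses (Fl : biform F) (Gl : biform G).
Hypothesis FG : forall x y, conv F G x y = cou x * cou y.

Lemma twist_inv V' W' Z' (cv' : V' -> tensC A V') (cw' : W' -> tensC A W')
    (k : V' -> W' -> Z') v w : is_comodule cv' -> is_comodule cw' -> bilin k ->
  twist cv' cw' F (twist cv' cw' G k) v w = k v w.
Proof.
move=> cv'P cw'P kl; rewrite twist_twist // -[RHS](twist_cou v w cv'P cw'P kl).
exact: eq_twist.
Qed.

Lemma twist12_inv k u v w : trilin k -> twist12 F (twist12 G k) u v w = k u v w.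
Proof. by move=> kl; apply: (twist_inv (k := fun u v => k u v w)); multilin. Qed.

Lemma twist23_inv k u v w : trilin k -> twist23 F (twist23 G k) u v w = k u v w.
Proof. by move=> kl; apply: twist_inv => //; exact: kl.2. Qed.

Lemma twistl_inv k u v w : trilin k -> twistl F (twistl G k) u v w = k u v w.
Proof.
move=> kl; rewrite /twistl twist3_twist3 //; try exact: biform_triforml.
rewrite -[RHS](twist3_cou cuP cvP cwP u v w kl).
by apply: eq_twist3 => // x y z; exact: conv3_mull.
Qed.

Lemma twistr_inv k u v w : trilin k -> twistr F (twistr G k) u v w = k u v w.
Proof.
move=> kl; rewrite /twistr twist3_twist3 //; try exact: biform_triformr.
rewrite -[RHS](twist3_cou cuP cvP cwP u v w kl).
by apply: eq_twist3 => // x y z; exact: conv3_mulr.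
Qed.
End OpInverse.

(** The inverse of the cocycle identity.  With the four operators named P, S, Q, R
    in the order of their definitions, [twist_cocycle] reads P Q = S R; each of
    them is inverted by the same operator for [gam'], so Q' P' = R' S'. *)
Lemma twist_cocycle_inv k u v w : trilin k ->
  twistl gbf (twist12 gbf k) u v w = twistr gbf (twist23 gbf k) u v w.
Proof.
move=> kl; pose X := twistr gbf (twist23 gbf k).
have Xl : trilin X by apply: twistr_trilin => //; apply: twist23_trilin.
have kE u' v' w' : k u' v' w' = twist12 gf (twistl gf X) u' v' w'.
  rewrite twist_cocycle // -[LHS](twist23_inv gl gbl conv_g_gb) //.
  apply: eq_twist => // v1 w1; rewrite (twistr_inv gl gbl conv_g_gb) //.
  exact: twist23_trilin.
rewrite -/X -[RHS](twistl_inv gbl gl conv_gb_g) //.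
apply: eq_twist3 => // u1 v1 w1.
rewrite -[RHS](twist12_inv gbl gl conv_gb_g); last exact: twistl_trilin.
exact: eq_twist.
Qed.

End Assoc.

Section AssocMaps.
Variables (U V W X Y Z : lmodType C) (cu : U -> tensC A U)
  (cv : V -> tensC A V) (cw : W -> tensC A W) (cx : X -> tensC A X)
  (cy : Y -> tensC A Y) (mu : U -> V -> X) (nu : V -> W -> Y)
  (k : X -> W -> Z) (l : U -> Y -> Z).
Hypotheses (cuP : is_comodule cu) (cvP : is_comodule cv)
  (cwP : is_comodule cw) (cxl : lin cx) (cyl : lin cy)
  (mul : bilin mu) (nul : bilin nu) (kl : bilin k) (ll : bilin l)
  (muP : codiagonal cu cv cx mu) (nuP : codiagonal cv cw cy nu).

Let cul : lin cu := comodule_lin cuP.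
Let cvl : lin cv := comodule_lin cvP.
Let cwl : lin cw := comodule_lin cwP.

(** Associativity laws survive deformation: both sides are twists of the trilinear
    map [k(mu(u, v), w)], by the two sides of the cocycle identity. *)
Lemma twist_assoc u v w :
  (forall u v w, k (mu u v) w = l u (nu v w)) ->
  twist cx cw gf k (twist cu cv gf mu u v) w =
  twist cu cy gf l u (twist cv cw gf nu v w).
Proof.
move=> kE.
have tkl : bilin (twist cx cw gf k) by exact: twist_bilin.
have tll : bilin (twist cu cy gf l) by exact: twist_bilin.
rewrite (@twist_post _ _ _ _ (fun x => twist cx cw gf k x w)) => [|]; last by multilin.
rewrite (@twist_post _ _ _ _ (twist cu cy gf l u)) => [|]; last by multilin.
transitivity (twist12 cu cv gf
  (twistl cu cv cw gf (fun u v w => k (mu u v) w)) u v w).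
  by apply: eq_twist => // u1 v1; apply: twist_codiagonall.
rewrite twist_cocycle //; last by multilin.
apply: eq_twist => // v1 w1; rewrite (twist_codiagonalr _ _ _ _ nuP) //.
exact: eq_twist3.
Qed.

(** The law runs backwards: associativity of the deformed maps gives the law for
    the original ones twisted by [gam']. *)
Lemma twist_assoc_inv u v w :
  (forall u v w, k (twist cu cv gf mu u v) w = l u (twist cv cw gf nu v w)) ->
  twist cx cw gbf k (mu u v) w = twist cu cy gbf l u (nu v w).
Proof.
move=> kE.
have tmul : bilin (twist cu cv gf mu) by exact: twist_bilin.
have tnul : bilin (twist cv cw gf nu) by exact: twist_bilin.
rewrite (twist_codiagonall _ _ _ _ muP) // (twist_codiagonalr _ _ _ _ nuP) //.
(* mu is recovered from its twist by twisting with gam' *)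
pose f u v w := k (twist cu cv gf mu u v) w.
transitivity (twistl cu cv cw gbf (twist12 cu cv gbf f) u v w).
  apply: eq_twist3 => // u1 v1 w1; rewrite /twist12 /f.
  rewrite -{1}(twist_inv gbl gl conv_gb_g u1 v1 cuP cvP mul).
  rewrite (@twist_post _ _ _ _ (fun x => k x w1)) //; multilin.
rewrite twist_cocycle_inv //; last by rewrite /f; multilin.
apply: eq_twist3 => // u1 v1 w1; rewrite /twist23 /f.
rewrite -(twist_inv gbl gl conv_gb_g v1 w1 cvP cwP nul).
rewrite (@twist_post _ _ _ _ (l u1)); last by multilin.
by apply: eq_twist.
Qed.

End AssocMaps.

End Cocycle.

End Twist.

(** * Covariance over the deformed Hopf algebra *)

Section Deform.
Variables (R : realType) (A : hopf R).
Local Notation C := R[i].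
Implicit Types U V W Z : lmodType C.
Hypothesis bialgA : is_bialgebra A.
Variables g gb : {scalar tensC A A}.
Hypothesis gP : is_2cocycle g gb.
Local Notation gf := (fun x y : A => g (x \ox y) : C).
Local Notation gbf := (fun x y : A => gb (x \ox y) : C).
Local Notation Ag := (deform_hopf g gb).
Local Notation biform F := (bilin (F : A -> A -> C^o)).

Let gl : biform gf := scalar_biform g.
Let gbl : biform gbf := scalar_biform gb.
Let ml : bilin (@amul R A) := amul_bilin bialgA.
Let copP : is_comodule (@cop R A) := cop_comodule bialgA.
Let copl : lin (@cop R A) := comodule_lin copP.

(** The action of bilinear forms on the other side: [F] is fed the last legs of the
    coproducts.  The deformed product is [gam] on the left and [gam'] on the
    right of the product of [A], see [deform_mulE]. *)
Definition rtwist Z (F : A -> A -> C) (k : A -> A -> Z) (x y : A) : Z :=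
  \Sw_(x1, x2 <- cop x) \Sw_(y1, y2 <- cop y) F x2 y2 *: k x1 y1.

Lemma rtwist_bilin Z F (k : A -> A -> Z) :
  biform F -> bilin k -> bilin (rtwist F k).
Proof. by move=> ? ?; rewrite /rtwist; multilin. Qed.

Lemma rtwist_post Z Z' (L : Z -> Z') F k x y : lin L ->
  L (rtwist F k x y) = rtwist F (fun x y => L (k x y)) x y.
Proof.
move=> Ll; rewrite /rtwist (tlift_sum _ _ Ll); apply: eq_tlift => x1 x2.
by rewrite (tlift_sum _ _ Ll); apply: eq_tlift => y1 y2; rewrite (linZ Ll).
Qed.

Lemma rtwist_twist Z F G (k : A -> A -> Z) x y :
  biform F -> biform G -> bilin k ->
  rtwist F (twist (@cop R A) (@cop R A) G k) x y =
  twist (@cop R A) (@cop R A) G (rtwist F k) x y.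
Proof.
move=> Fl Gl kl.
pose f x y x' y' v w := (F v w * G x y : C) *: k x' y'.
transitivity (\Sw_(a, x2 <- cop x) \Sw_(b, y2 <- cop y)
    \Sw_(a1, a2 <- cop a) \Sw_(b1, b2 <- cop b) f a1 b1 a2 b2 x2 y2).
  do 2!(apply: eq_tlift => ? ?).
  rewrite (@twist_post _ _ _ _ _ _ (fun z => _ *: z)); last by multilin.
  by do 2!(apply: eq_tlift => ? ?); rewrite scalerA mulrC.
rewrite -coassoc2 //; try by rewrite /f; multilin.
do 2!(apply: eq_tlift => ? ?).
rewrite (@rtwist_post _ _ (fun z => _ *: z)); last by multilin.
by do 2!(apply: eq_tlift => ? ?); rewrite scalerA.
Qed.

Lemma rtwist_rtwist Z F G (k : A -> A -> Z) x y :
  biform F -> biform G -> bilin k ->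
  rtwist F (rtwist G k) x y = rtwist (conv G F) k x y.
Proof.
move=> Fl Gl kl.
pose f x y x' y' v w := (G x' y' * F v w : C) *: k x y.
transitivity (\Sw_(a, x2 <- cop x) \Sw_(b, y2 <- cop y)
    \Sw_(a1, a2 <- cop a) \Sw_(b1, b2 <- cop b) f a1 b1 a2 b2 x2 y2).
  do 2!(apply: eq_tlift => ? ?).
  rewrite (@rtwist_post _ _ (fun z => _ *: z)); last by multilin.
  by do 2!(apply: eq_tlift => ? ?); rewrite scalerA.
rewrite -coassoc2 //; try by rewrite /f; multilin.
do 2!(apply: eq_tlift => ? ?); rewrite /conv.
rewrite (@tlift_sum _ _ _ _ _ _ C^o _ (fun c => c *: _)); last by multilin.
apply: eq_tlift => ? ?.
by rewrite (@tlift_sum _ _ _ _ _ _ C^o _ (fun c => c *: _)); last by multilin.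
Qed.

Lemma rtwist_cou Z (k : A -> A -> Z) x y : bilin k ->
  rtwist (fun x y => cou x * cou y) k x y = k x y.
Proof.
move=> kl; have [_ [_ _ copr] _ _ _] := bialgA.
rewrite -{2}[x]copr (tlift_sum _ _ (kl.1 y)); apply: eq_tlift => x1 x2.
rewrite -{2}[y]copr (tlift_sum _ _ (kl.2 _)); apply: eq_tlift => y1 y2.
by rewrite (linZ (kl.1 _)) (linZ (kl.2 _)) scalerA.
Qed.

Lemma deform_mulE (x y : Ag) :
  amul x y = twist (@cop R A) (@cop R A) gf (rtwist gbf (@amul R A)) x y :> A.
Proof.
have Sw3E Z (f : A -> A -> A -> Z) h : trilin f ->
    Sw3 f h = \Sw_(h1, h' <- cop h) \Sw_(h2, h3 <- cop h') f h1 h2 h3.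
  by move=> fl; rewrite (coassoc _ copP fl).
rewrite /= Sw3E; last by rewrite /Sw3; multilin.
apply: eq_tlift => x1 x'.
transitivity (\Sw_(x2, x3 <- cop x') \Sw_(y1, y' <- cop y)
  \Sw_(y2, y3 <- cop y') (g (x1 \ox y1) * gb (x3 \ox y3) : C) *: amul x2 y2).
  by apply: eq_tlift => x2 x3; rewrite Sw3E; last by multilin.
rewrite tlift_exch; apply: eq_tlift => y1 y'.
rewrite (@rtwist_post _ _ (fun z => _ *: z)); last by multilin.
by do 2!(apply: eq_tlift => ? ?); rewrite scalerA mulrC.
Qed.

Lemma deform_mul_bilin : bilin (@amul R Ag : A -> A -> A).
Proof.
have tl : bilin (twist (@cop R A) (@cop R A) gf (rtwist gbf (@amul R A))).
  by apply: twist_bilin => //; apply: rtwist_bilin.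
by split=> x c u v; rewrite !deform_mulE; [exact: tl.1|exact: tl.2].
Qed.

(** Acting by [gam] on the right of the deformed product removes its factor
    [gam'], because the two sided actions commute. *)
Lemma rtwist_deform_mul x y :
  rtwist gf (@amul R Ag : A -> A -> A) x y =
  twist (@cop R A) (@cop R A) gf (@amul R A) x y.
Proof.
transitivity (rtwist gf
  (twist (@cop R A) (@cop R A) gf (rtwist gbf (@amul R A))) x y).
  by do 2!(apply: eq_tlift => ? ?); rewrite deform_mulE.
rewrite rtwist_twist //; last exact: rtwist_bilin.
apply: eq_twist => // x' y'; rewrite rtwist_rtwist // -[RHS](rtwist_cou x' y' ml).
by do 2!(apply: eq_tlift => ? ?); rewrite (conv_gb_g gP).
Qed.

(** The coaction of [twist g mu u v] has weight [gam(x1, y1)] and first leg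
    [x2 y2]; by [rtwist_deform_mul] this is the deformed product [x1 . y1] with the
    weight [gam(x2, y2)], which is absorbed by the twist of [mu] in the second
    leg. *)
Lemma deform_codiagonal U V W (cu : U -> tensC A U) (cv : V -> tensC A V)
    (cw : W -> tensC A W) (mu : U -> V -> W) :
  is_comodule cu -> is_comodule cv -> lin cw -> bilin mu ->
  codiagonal cu cv cw mu ->
  @codiagonal R Ag U V W cu cv cw (twist cu cv gf mu).
Proof.
move=> cuP cvP cwl mul muP u v.
have dl := deform_mul_bilin.
pose f (x y x' y' : A) u v := gf x y *: (amul x' y' \ox mu u v).
pose f' (x y x' y' : A) u v := gf x' y' *: ((@amul R Ag x y : A) \ox mu u v).
transitivity (\Sw_(x, u0 <- cu u) \Sw_(y, v0 <- cv v)
    \Sw_(x', u1 <- cu u0) \Sw_(y', v1 <- cv v0) f x y x' y' u1 v1).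
  rewrite (@twist_post _ _ _ _ _ _ cw) //; do 2!(apply: eq_tlift => ? ?).
  rewrite muP; do 2!(rewrite (@tlift_sum _ _ _ _ _ _ _ _ (fun z => _ *: z));
    [apply: eq_tlift => ? ?|by multilin]).
  by [].
transitivity (\Sw_(x, u0 <- cu u) \Sw_(y, v0 <- cv v)
    \Sw_(x', u1 <- cu u0) \Sw_(y', v1 <- cv v0) f' x y x' y' u1 v1); last first.
  do 2!(apply: eq_tlift => ? ?).
  rewrite (@twist_post _ _ _ _ _ _ (fun z => _ \ox z)); last by multilin.
  by [].
rewrite !coassoc2 //; try by rewrite /f'; multilin.
  2,3: by rewrite /f; multilin.
apply: eq_tlift => x u0; apply: eq_tlift => y v0.
transitivity (twist (@cop R A) (@cop R A) gf (@amul R A) x y \ox mu u0 v0).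
  by rewrite (@twist_post _ _ _ _ _ _ (fun z => z \ox _)); last by multilin.
rewrite -rtwist_deform_mul.
by rewrite (@rtwist_post _ _ (fun z => z \ox _)); last by multilin.
Qed.

End Deform.

(** * Covariant bimodules and their tensor products *)

Section Bimodules.
Variables (R : realType) (A : hopf R) (B : coalg_algebra A).
Local Notation C := R[i].

Lemma tens_linP (M N Z : lmodType C) (D : Type) (ra : M -> D -> M)
    (la : D -> N -> N) (f h : tens ra la -> Z) :
  lin f -> lin h -> (forall m n, f (tpure m n) = h (tpure m n)) ->
  forall t, f t = h t.
Proof.
move=> fl hl fh t; rewrite [t]tens_sum !(lin_sum _ _ _ fl) (lin_sum _ _ _ hl).
exact: eq_bigr.
Qed.

Section Structure.
Hypothesis BP : is_comodule_algebra B.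
Variable E : bimod B.
Hypothesis EP : is_cov_bimodule E.

Lemma bcoact_comodule : is_comodule (@bcoact R A B E).
Proof. by case: EP. Qed.

Lemma lact_bilin : bilin (@lact R A B E).
Proof. by case: EP => -[[H1 H2] _ _ _ _] _ _; split=> *; [exact: H2|exact: H1]. Qed.

Lemma ract_bilin : bilin (@ract R A B E).
Proof. by case: EP => -[_ [H1 H2] _ _ _] _ _; split=> *; [exact: H1|exact: H2]. Qed.

Hypothesis bialgA : is_bialgebra A.

(** The covariance axiom treats both actions at once; acting by the coinvariant
    unit on one side isolates the other. *)
Lemma lact_codiagonal :
  codiagonal (@coact R A B) (@bcoact R A B E) (@bcoact R A B E) (@lact R A B E).
Proof.
move=> b e; have ml := amul_bilin bialgA; have rl := ract_bilin.
have [[_ _ _ [_ r1] _] _ coE] := EP; have [_ _ _ co1] := BP.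
have [[_ _ _ _ m1] _ _ _ _] := bialgA.
rewrite -[lact b e]r1 coE; do 2!(apply: eq_tlift => ? ?).
by rewrite co1 tlift_ox; [rewrite m1 r1|multilin].
Qed.

Lemma ract_codiagonal :
  codiagonal (@bcoact R A B E) (@coact R A B) (@bcoact R A B E) (@ract R A B E).
Proof.
move=> e b; have ml := amul_bilin bialgA; have rl := ract_bilin.
have ll := lact_bilin.
have [[_ _ [_ l1] _ _] _ coE] := EP; have [_ _ _ co1] := BP.
have [[_ _ _ m1 _] _ _ _ _] := bialgA.
rewrite -{1}[e]l1 coE co1 tlift_ox; last by multilin.
by do 2!(apply: eq_tlift => ? ?); rewrite m1 l1.
Qed.

End Structure.

Section TensB.
Hypothesis BP : is_comodule_algebra B.
Hypothesis bialgA : is_bialgebra A.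
Variables V W : bimod B.
Hypotheses (VP : is_cov_bimodule V) (WP : is_cov_bimodule W).
Local Notation T := (tensB V W).

Let Vc := bcoact_comodule VP.
Let Wc := bcoact_comodule WP.

(** Tensors over [B] are only scaled in the left factor; scalars pass to the right
    factor as multiples of the unit of [B]. *)
Lemma bilin_tpureB : bilin (@tpureB R A B V W).
Proof.
have [[_ _ _ [_ r1] _] _ _] := VP; have [[_ _ [_ l1] _ _] _ _] := WP.
split=> x c u v; rewrite /tpureB; first by rewrite tpureDl tpureZl.
rewrite tpureDr -{1}[u]l1 -(linZ ((lact_bilin WP).1 u)) -tpure_bal.
by rewrite (linZ ((ract_bilin VP).2 x)) r1 tpureZl.
Qed.
Let tpl := bilin_tpureB.

Lemma tpureB_bal (v : V) b (w : W) : tpureB (ract v b) w = tpureB v (lact b w).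
Proof. exact: tpure_bal. Qed.

Let ml := amul_bilin bialgA.
Let amulA : associative (@amul R A).
Proof. by case: bialgA => -[]. Qed.
Let Vl := comodule_lin Vc.
Let Wl := comodule_lin Wc.
Let Bc : is_comodule (@coact R A B).
Proof. by case: BP. Qed.
Let Bl := comodule_lin Bc.

Let cot (v : V) (w : W) : tensC A T := \Sw_(x, v0 <- bcoact v)
  \Sw_(y, w0 <- bcoact w) amul x y \ox tpureB v0 w0.

Let cot_bilin : bilin cot.
Proof. by rewrite /cot; multilin. Qed.

Let cot_bal (v : V) b (w : W) : cot (ract v b) w = cot v (lact b w).
Proof.
rewrite /cot (tlift_codiagonal (h := fun x v0 => \Sw_(y, w0 <- bcoact w)
  amul x y \ox tpureB v0 w0) _ _ (ract_codiagonal BP VP bialgA)); last by multilin.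
apply: eq_tlift => x v0; rewrite (tlift_codiagonal (h := fun y w0 =>
  amul x y \ox tpureB v0 w0) _ _ (lact_codiagonal BP WP bialgA)); last by multilin.
do 2!(apply: eq_tlift => ? ?); by rewrite amulA tpureB_bal.
Qed.

Lemma tensB_coact_lin : lin (@bcoact R A B T).
Proof. exact: (lin_tliftB cot_bilin cot_bal). Qed.

Lemma tpureB_codiagonal :
  codiagonal (@bcoact R A B V) (@bcoact R A B W) (@bcoact R A B T)
    (@tpureB R A B V W).
Proof. by move=> v w; exact: (tliftB_pure cot_bilin cot_bal). Qed.

Let lt_bilin b : bilin (fun (v : V) (w : W) => tpureB (lact b v) w).
Proof. by have ll := lact_bilin VP; multilin. Qed.

Let lt_bal b (v : V) c (w : W) :
  tpureB (lact b (ract v c)) w = tpureB (lact b v) (lact c w).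
Proof. by have [[_ _ _ _ rl] _ _] := VP; rewrite -rl tpureB_bal. Qed.

Lemma tensB_lact_pure b (v : V) (w : W) :
  lact b (tpureB v w : T) = tpureB (lact b v) w.
Proof. exact: (tliftB_pure (lt_bilin b) (@lt_bal b)). Qed.

Lemma tensB_lact_bilin : bilin (@lact R A B T).
Proof.
split=> [t|b]; last exact: (lin_tliftB (lt_bilin b) (@lt_bal b)).
by apply: lin_tlift => v w; have ll := lact_bilin VP; multilin.
Qed.

End TensB.
End Bimodules.

(** * The functor Gamma and its monoidal structure *)

Section Gamma.
Variables (R : realType) (A : hopf R) (B : coalg_algebra A).
Local Notation C := R[i].
Hypothesis BP : is_comodule_algebra B.
Hypothesis bialgA : is_bialgebra A.
Variables g gb : {scalar tensC A A}.
Hypothesis gP : is_2cocycle g gb.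
Local Notation gf := (fun x y : A => g (x \ox y) : C).
Local Notation gbf := (fun x y : A => gb (x \ox y) : C).
Local Notation Ag := (deform_hopf g gb).
Local Notation Bg := (deform_alg g gb B).

Let gl : bilin (gf : A -> A -> C^o) := scalar_biform g.
Let gbl : bilin (gbf : A -> A -> C^o) := scalar_biform gb.

Let Bc : is_comodule (@coact R A B).
Proof. by case: BP. Qed.
Let Bl := comodule_lin Bc.

Lemma amulB_bilin : bilin (@amul R B).
Proof. by case: BP => -[H1 H2 _ _ _] *; split=> *; [exact: H2|exact: H1]. Qed.

Lemma amulB_codiagonal :
  codiagonal (@coact R A B) (@coact R A B) (@coact R A B) (@amul R B).
Proof. by case: BP. Qed.

(** Unitality of the cocycle: twisting is invisible at a coinvariant argument. *)
Lemma twist_onel (V W Z : lmodType C) (cv : V -> tensC A V) (cw : W -> tensC A W)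
    (k : V -> W -> Z) (e : V) w :
  is_comodule cw -> cv e = aone A \ox e -> bilin k ->
  twist cv cw gf k e w = k e w.
Proof.
move=> cwP eP kl; have cwl := comodule_lin cwP.
rewrite /twist eP (tlift_ox (f := fun x v0 =>
  \Sw_(y, w0 <- cw w) gf x y *: k v0 w0)); last by multilin.
rewrite -[RHS](counit w cwP (kl.2 e)); apply: eq_tlift => y w0.
by have [_ _ /(_ y)[_ ->]] := gP.
Qed.

Lemma twist_oner (V W Z : lmodType C) (cv : V -> tensC A V) (cw : W -> tensC A W)
    (k : V -> W -> Z) v (e : W) :
  is_comodule cv -> cw e = aone A \ox e -> bilin k ->
  twist cv cw gf k v e = k v e.
Proof.
move=> cvP eP kl; rewrite -[RHS](counit v cvP (kl.1 e)); apply: eq_tlift => x v0.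
rewrite eP (tlift_ox (f := fun y w0 => gf x y *: k v0 w0)); last by multilin.
by have [_ _ /(_ x)[-> _]] := gP.
Qed.

Section One.
Variable E : bimod B.
Hypothesis EP : is_cov_bimodule E.

Let Ec := bcoact_comodule EP.
Let El := comodule_lin Ec.
Let ll := lact_bilin EP.
Let rl := ract_bilin EP.
Let lc := lact_codiagonal BP EP bialgA.
Let rc := ract_codiagonal BP EP bialgA.

Lemma Gamma_bimodule : is_bimodule (Gamma g gb E).
Proof.
have [[_ _ [lA l1] [rA r1] lrA] _ _] := EP; have [_ _ _ co1] := BP.
have lgl : bilin (twist (@coact R A B) (@bcoact R A B E) gf (@lact R A B E)).
  exact: twist_bilin.
have rgl : bilin (twist (@bcoact R A B E) (@coact R A B) gf (@ract R A B E)).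
  exact: twist_bilin.
split.
- by split; [exact: lgl.2|exact: lgl.1].
- by split; [exact: rgl.1|exact: rgl.2].
- split=> [a b e|e].
    symmetry; apply: (twist_assoc bialgA gP) => //; try exact: amulB_bilin.
    exact: amulB_codiagonal.
  by rewrite -[RHS]l1; apply: twist_onel.
- split=> [a b e|e].
    apply: (twist_assoc bialgA gP) => //; try exact: amulB_bilin.
    exact: amulB_codiagonal.
  by rewrite -[RHS]r1; apply: twist_oner.
- move=> a b e; exact: (twist_assoc bialgA gP).
Qed.

Lemma Gamma_cov_bimodule : is_cov_bimodule (Gamma g gb E).
Proof.
split; [exact: Gamma_bimodule | exact: Ec |] => a b e.
have dl := deform_mul_bilin bialgA g gb.
have rgl : bilin (twist (@bcoact R A B E) (@coact R A B) gf (@ract R A B E)).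
  exact: twist_bilin.
have rgc := deform_codiagonal bialgA gP Ec Bc El rl rc.
have lgc := deform_codiagonal bialgA gP Bc Ec El ll lc.
rewrite [LHS]rgc.
rewrite (tlift_codiagonal (A := Ag) (h := fun x e0 => \Sw_(z, b0 <- coact b)
  (@amul R Ag x z \ox
   twist (@bcoact R A B E) (@coact R A B) gf (@ract R A B E) e0 b0)) _ _ lgc) //.
by multilin.
Qed.

End One.

Section Phi.
Variables V W : bimod B.
Hypotheses (VP : is_cov_bimodule V) (WP : is_cov_bimodule W).

Let Vc := bcoact_comodule VP.
Let Wc := bcoact_comodule WP.
Let Vl := comodule_lin Vc.
Let Wl := comodule_lin Wc.
Let tpl := bilin_tpureB VP WP.
Let gVP := Gamma_cov_bimodule VP.
Let gWP := Gamma_cov_bimodule WP.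
Let tpgl := bilin_tpureB gVP gWP.
Let Tl := tensB_coact_lin BP bialgA VP WP.
Let Tc := tpureB_codiagonal BP bialgA VP WP.
Local Notation T := (tensB V W).
Local Notation Tg := (tensB (Gamma g gb V) (Gamma g gb W)).
Local Notation tw := (twist (@bcoact R A B V) (@bcoact R A B W)).
Local Notation tp := (@tpureB R A B V W).
Local Notation tpg := (@tpureB R Ag Bg (Gamma g gb V) (Gamma g gb W)).

Let phif_bilin : bilin (tw gf tp). Proof. exact: twist_bilin. Qed.
Let psif_bilin : bilin (tw gbf tpg). Proof. exact: twist_bilin. Qed.

(* Both legs of the balancing relation are deformed actions, which is the law
   (v b) (x) w = v (x) (b w) deformed by [twist_assoc]. *)
Let phif_bal (v : V) (b : B) (w : W) :
  tw gf tp (@ract R Ag Bg (Gamma g gb V) v b) w =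
  tw gf tp v (@lact R Ag Bg (Gamma g gb W) b w).
Proof.
exact: (twist_assoc bialgA gP Vc Bc Wc Vl Wl (ract_bilin VP)
  tpl tpl (ract_codiagonal BP VP bialgA) (lact_codiagonal BP WP bialgA)
  v b w (@tpureB_bal _ _ _ _ _)).
Qed.

(* Here the law holds for the deformed actions, and is wanted for the original
   ones. *)
Let psif_bal (v : V) (b : B) (w : W) :
  tw gbf tpg (ract v b) w = tw gbf tpg v (lact b w).
Proof.
exact: (twist_assoc_inv bialgA gP Vc Bc Wc (ract_bilin VP) (lact_bilin WP)
  tpgl tpgl (ract_codiagonal BP VP bialgA) (lact_codiagonal BP WP bialgA)
  v b w (@tpureB_bal R Ag Bg (Gamma g gb V) (Gamma g gb W))).
Qed.

(** The inverse of [phi]. *)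
Definition psi (t : T) : Tg := tlift (tw gbf tpg) t.

Lemma phi_lin : lin (@phi R A g gb B V W : Tg -> T).
Proof. exact: (lin_tliftB phif_bilin phif_bal). Qed.

Lemma phi_pure v w : phi g gb V W (tpg v w) = tw gf tp v w.
Proof. exact: (tliftB_pure phif_bilin phif_bal). Qed.

Lemma psi_lin : lin psi.
Proof. exact: (lin_tliftB psif_bilin psif_bal). Qed.

Lemma psi_pure v w : psi (tp v w) = tw gbf tpg v w.
Proof. exact: (tliftB_pure psif_bilin psif_bal). Qed.

Lemma phiK : cancel (@phi R A g gb B V W) psi.
Proof.
apply: tens_linP; [exact: lin_comp psi_lin phi_lin | exact: lin_id | move=> v w].
rewrite [phi _ _ _ _ _]phi_pure (twist_post _ _ _ _ _ _ psi_lin).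
rewrite -[RHS](twist_inv gl gbl (conv_g_gb gP) v w Vc Wc tpgl).
by apply: eq_twist => // *; exact: psi_pure.
Qed.

Lemma psiK : cancel psi (@phi R A g gb B V W).
Proof.
apply: tens_linP; [exact: lin_comp phi_lin psi_lin | exact: lin_id | move=> v w].
rewrite [psi _]psi_pure (twist_post _ _ _ _ _ _ phi_lin).
rewrite -[RHS](twist_inv gbl gl (conv_gb_g gP) v w Vc Wc tpl).
by apply: eq_twist => // *; exact: phi_pure.
Qed.

Lemma phi_bijective : bijective (@phi R A g gb B V W).
Proof. exact: Bijective phiK psiK. Qed.

Lemma phiV_psi t : phiV g gb V W t = psi t.
Proof.
apply: (can_inj phiK); rewrite psiK /phiV /inverse.
by case: xgetP => [x _ //|/(_ (psi t))]; case; exact: psiK.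
Qed.

(** [deform_codiagonal] for the map (v, w) |-> v (x)_B w, applied to each term of a
    representative of [t]. *)
Lemma phi_coact (t : Tg) :
  \Sw_(x, s <- @bcoact R Ag Bg Tg t) (x : A) \ox (phi g gb V W s : T) =
  @bcoact R A B T (phi g gb V W t).
Proof.
have pl := phi_lin.
have hl : bilin (fun (x : A) (s : Tg) => x \ox (phi g gb V W s : T)) by multilin.
rewrite (tlift_sum _ _ (tliftC_lin hl)) [RHS](tlift_sum _ _ Tl).
apply: eq_tlift => v w.
rewrite [RHS](deform_codiagonal bialgA gP Vc Wc Tl tpl Tc).
rewrite (tlift_sum _ _ (tliftC_lin hl)); apply: eq_tlift => x v0.
rewrite (tlift_sum _ _ (tliftC_lin hl)); apply: eq_tlift => y w0.
by rewrite (tlift_ox hl) phi_pure.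
Qed.

Lemma psi_coact (s : T) :
  @bcoact R Ag Bg Tg (psi s) =
  \Sw_(x, s0 <- @bcoact R A B T s) (x : A) \ox psi s0.
Proof.
have pl := phi_lin; have ql := psi_lin.
have hl : bilin (fun (x : A) (s : T) => x \ox psi s) by multilin.
rewrite -{2}[s]psiK -phi_coact (tlift_sum _ _ (tliftC_lin hl)).
rewrite -[LHS]tlift_id; apply: eq_tlift => x t.
by rewrite (tlift_ox hl) phiK.
Qed.

Lemma phi_lact (b : B) (t : Tg) :
  phi g gb V W (@lact R Ag Bg Tg b t) =
  @lact R Ag Bg (Gamma g gb T) b (phi g gb V W t).
Proof.
have Tal := tensB_lact_bilin VP WP.
have gTl : bilin (@lact R Ag Bg (Gamma g gb T) : B -> T -> T) by exact: twist_bilin.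
rewrite (tlift_sum _ _ phi_lin) [RHS](tlift_sum _ _ (gTl.2 b)).
apply: eq_tlift => v w; rewrite phi_pure.
apply: (twist_assoc bialgA gP) => //.
- exact: lact_bilin.
- exact: lact_codiagonal.
- by move=> *; rewrite tensB_lact_pure.
Qed.

End Phi.

End Gamma.

(** * Bidegree components of forms *)

Lemma choice_dep (I : Type) (T : I -> Type) (P : forall i, T i -> Prop) :
  (forall i, exists x, P i x) -> exists h : forall i, T i, forall i, P i (h i).
Proof. by move=> PT; exists (fun i => sval (cid (PT i))) => i; case: cid. Qed.

Section Complex.
Variables (R : realType) (A : hopf R) (B : coalg_algebra A).
Local Notation C := R[i].
Variable W : complex_structure B.
Hypothesis WP : is_cov_complex_structure W.
Hypothesis bialgA : is_bialgebra A.

Lemma calculusP : is_cov_calculus W.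
Proof. by case: WP => -[]. Qed.

Lemma OmP p q : is_cov_bimodule (Om W p q).
Proof. by case: WP => _ /(_ p q)[]. Qed.

Lemma incP p q : is_inclusion (@inc _ _ _ W p q).
Proof. by case: WP => _ /(_ p q)[]. Qed.

Lemma cincP k : is_inclusion (@cinc _ _ _ W k).
Proof. by case: calculusP => -[[_ /(_ k)[]]]. Qed.

Lemma inc_lin p q : lin (@inc _ _ _ W p q).
Proof. by case: (incP p q). Qed.

Lemma cinc_lin k : lin (@cinc _ _ _ W k).
Proof. by case: (cincP k). Qed.

Lemma inc_colinear p q :
  colinear (@bcoact R A B (Om W p q)) (@coact R A W) (@inc _ _ _ W p q).
Proof. by case: (incP p q). Qed.

Lemma inc_lact p q b (w : Om W p q) : inc (lact b w) = amul (cB W b) (inc w).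
Proof. by case: (incP p q). Qed.

Lemma inc_ract p q b (w : Om W p q) : inc (ract w b) = amul (inc w) (cB W b).
Proof. by case: (incP p q). Qed.

Lemma total_algebraP : is_comodule_algebra W.
Proof. by case: calculusP => -[[]]. Qed.

Lemma inc_cinc p q (w : Om W p q) : exists v : cOm W (p + q), inc w = cinc v.
Proof. by case: WP => _ _ [H _ _] _ _; exact: H. Qed.

Lemma Om_cast p m n (x : Om W p m) : m = n -> exists u : Om W p n, inc x = inc u.
Proof. by move=> <-; exists x. Qed.

Lemma cOm_cast m n (x : cOm W m) : m = n -> exists u : cOm W n, cinc x = cinc u.
Proof. by move=> <-; exists x. Qed.

Lemma inc_inj p q : injective (@inc _ _ _ W p q).
Proof.
have inc0 m (x : Om W p m) : m = (p + q - p)%N -> inc x = 0 -> x = 0.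
  move=> em; move: x; rewrite em => x x0.
  case: WP => _ _ [_ _ dsum] _ _.
  pose f := @dfwith _ (fun i => Om W i (p + q - i) : Type) (fun=> 0) p x.
  have fp : f p = x by exact: dfwith_in.
  have fi i : i != p -> f i = 0 by move=> ip; apply: dfwith_out; rewrite eq_sym.
  have /dsum/(_ p (leq_addr _ _)) : \sum_(i < (p + q).+1) inc (f i) = 0.
    rewrite big1 // => i _; have [->|/fi ->] := eqVneq (i : nat) p.
      by rewrite fp.
    by rewrite (lin0 (@inc_lin _ _)).
  by rewrite fp.
move=> u v uv; apply/eqP; rewrite -subr_eq0; apply/eqP.
apply: inc0; first by rewrite addKn.
by rewrite -scaleN1r addrC (@inc_lin p q) uv scaleN1r addNr.
Qed.

(** The components are kept inside the total algebra, which avoids transporting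
    along equalities between bidegrees; the decomposition must hold for all large
    cutoffs [N] so that two of them can be compared at a common one. *)
Definition bidecomp (w : W) (f : nat -> nat -> W) :=
  (forall p q, exists u : Om W p q, f p q = inc u) /\
  exists n, forall N, (n <= N)%N ->
    w = \sum_(k < N) \sum_(p < k.+1) f p (k - p)%N.

Lemma bidecomp_ex w : exists f, bidecomp w f.
Proof.
case: calculusP => -[[_ _ [/(_ w)[n [h wE]] _] _] _] _ _ _.
have [_ _ [_ dec _] _ _] := WP.
have [F FE] : exists F : forall k p, Om W p (k - p),
    forall k, cinc (h k) = \sum_(p < k.+1) inc (F k p).
  exact: (choice_dep (fun k => dec k (h k))).
pose G k p : W := if (k < n)%N then inc (F k p) else 0.
exists (fun p q => G (p + q)%N p); split=> [p q|].
  rewrite /G; case: ifP => _; last by exists 0; rewrite (lin0 (@inc_lin _ _)).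
  by apply: Om_cast; rewrite addKn.
exists n => N nN.
transitivity (\sum_(k < N) if (k < n)%N then cinc (h k) else 0).
  rewrite -big_mkcond /= wE.
  by rewrite (big_ord_widen N (fun k => cinc (h k))).
apply: eq_bigr => k _; transitivity (\sum_(p < k.+1) G k p).
  rewrite /G; case: ifP => _; first by rewrite FE.
  by rewrite big1.
by apply: eq_bigr => p _; rewrite subnKC // -ltnS.
Qed.

Lemma bidecompP c w w' f f' : bidecomp w f -> bidecomp w' f' ->
  bidecomp (c *: w + w') (fun p q => c *: f p q + f' p q).
Proof.
move=> [fr [n wE]] [fr' [n' wE']]; split=> [p q|].
  have [[u ->] [u' ->]] := (fr p q, fr' p q).
  by exists (c *: u + u'); rewrite (@inc_lin p q).
exists (maxn n n') => N; rewrite geq_max => /andP[nN n'N].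
rewrite {1}(wE N nN) {1}(wE' N n'N) scaler_sumr -big_split /=.
by apply: eq_bigr => k _; rewrite scaler_sumr -big_split.
Qed.

Lemma bidecomp0 f : bidecomp 0 f -> forall p q, f p q = 0.
Proof.
move=> [fr [n fE]] p q; set k := (p + q)%N.
have [h hE] : exists h : forall k, cOm W k,
    forall k, \sum_(p < k.+1) f p (k - p)%N = cinc (h k).
  apply: (@choice_dep nat (cOm W)
    (fun k v => \sum_(p < k.+1) f p (k - p)%N = cinc v)).
  move=> j; pose P (x : W) := exists v : cOm W j, x = cinc v.
  apply: (big_ind P) => [|x y [u ->] [v ->]|i _].
  - by exists 0; rewrite (lin0 (@cinc_lin _)).
  - by exists (u + v); rewrite (linD (@cinc_lin _)).
  have [u ->] := fr i (j - i)%N; have [v ->] := inc_cinc u.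
  by apply: cOm_cast; rewrite subnKC // -ltnS.
have hk : h k = 0.
  case: calculusP => -[[_ _ [_ dsum] _] _] _ _ _.
  apply: (dsum (maxn n k.+1)); last by rewrite leq_max leqnn orbT.
  by rewrite [RHS](fE (maxn n k.+1)) ?leq_maxl //; apply: eq_bigr.
have [x xE] : exists x : forall i, Om W i (k - i),
    forall i, f i (k - i)%N = inc (x i).
  exact: (choice_dep (fun i => fr i (k - i)%N)).
have [_ _ [_ _ dsum] _ _] := WP.
have : \sum_(i < k.+1) inc (x i) = 0.
  rewrite -[RHS](lin0 (@cinc_lin k)) -hk -hE.
  by apply: eq_bigr => i _; rewrite xE.
move=> /dsum/(_ p (leq_addr _ _)) xp.
by have := xE p; rewrite xp (lin0 (@inc_lin _ _)) addKn.
Qed.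

Lemma bidecomp_uniq w f f' : bidecomp w f -> bidecomp w f' ->
  forall p q, f p q = f' p q.
Proof.
move=> wf wf' p q; have := bidecompP (-1) wf wf'.
rewrite scaleN1r addNr => /bidecomp0/(_ p q)/eqP.
by rewrite scaleN1r addrC subr_eq0 => /eqP.
Qed.

Lemma bidecomp_inc p q (u : Om W p q) :
  bidecomp (inc u)
    (fun p' q' => if (p' == p) && (q' == q) then inc u else 0).
Proof.
split=> [p' q'|].
  case: ifP => [/andP[/eqP-> /eqP->]|_]; first by exists u.
  by exists 0; rewrite (lin0 (@inc_lin _ _)).
exists (p + q).+1 => N kN.
have pk : (p < (p + q).+1)%N by rewrite ltnS leq_addr.
rewrite (bigD1 (Ordinal kN)) //= (bigD1 (Ordinal pk)) //= addKn !eqxx /=.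
rewrite !big1 ?addr0 // => [i ik|i ip].
  apply: big1 => j _; case: ifP => // /andP[/eqP jp /eqP jq].
  case/eqP: ik; apply: val_inj.
  by rewrite /= -jp -jq subnKC // -ltnS.
by case: ifP => // /andP[/eqP e _]; case/eqP: ip; apply: val_inj.
Qed.

(** The (p,q)-component of an arbitrary form.  Unlike [proj], whose value is
    specified only on forms of degree p + q, it is linear on the whole algebra;
    the two agree in degree p + q, see [proj_bipart]. *)
Definition bipart p q (w : W) : Om W p q :=
  xget 0 [set u | exists f, bidecomp w f /\ f p q = inc u]%classic.

Lemma bipartP w f p q : bidecomp w f -> inc (bipart p q w) = f p q.
Proof.
move=> wf; rewrite /bipart; case: xgetP => [u _ [f' [wf' <-]]|].
  exact: bidecomp_uniq wf' wf _ _.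
by case: (wf.1 p q) => u fu /(_ u)[]; exists f.
Qed.

Lemma bipart_lin p q : lin (bipart p q).
Proof.
move=> c w w'; have [[f wf] [f' wf']] := (bidecomp_ex w, bidecomp_ex w').
apply: inc_inj; rewrite (@inc_lin p q) (bipartP _ _ wf) (bipartP _ _ wf').
by rewrite (bipartP _ _ (bidecompP c wf wf')).
Qed.

Lemma bipart_inc p q (u : Om W p q) : bipart p q (inc u) = u.
Proof. by apply: inc_inj; rewrite (bipartP _ _ (bidecomp_inc u)) !eqxx. Qed.

Lemma bipart_inc0 p q p' q' (u : Om W p' q') :
  (p, q) != (p', q') -> bipart p q (inc u) = 0.
Proof.
move=> /negPf ne; apply: inc_inj; rewrite (bipartP _ _ (bidecomp_inc u)).
by rewrite (lin0 (@inc_lin _ _)) -xpair_eqE ne.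
Qed.

Lemma lin_inc_ext (Z : lmodType C) (L L' : W -> Z) : lin L -> lin L' ->
  (forall p q (u : Om W p q), L (inc u) = L' (inc u)) -> forall w, L w = L' w.
Proof.
move=> Ll Ll' LL w; have [f [fr [n /(_ n (leqnn n)) ->]]] := bidecomp_ex w.
rewrite (lin_sum _ _ _ Ll) (lin_sum _ _ _ Ll'); apply: eq_bigr => k _.
rewrite (lin_sum _ _ _ Ll) (lin_sum _ _ _ Ll'); apply: eq_bigr => p _.
by have [u ->] := fr p (k - p)%N.
Qed.

(** Forms are sums of homogeneous ones, and on these the claim is that each
    Omega^(p,q) is a subcomodule.  Having such a retraction of [inc] is what makes
    id (x) [inc] cancellable when colinearity is deduced from that of [d]. *)
Lemma bipart_colinear p q :
  colinear (@coact R A W) (@bcoact R A B (Om W p q)) (bipart p q).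
Proof.
have pl := @bipart_lin p q.
have cl := comodule_lin (bcoact_comodule (OmP p q)).
have wl : lin (@coact R A W) by case: total_algebraP => _ /comodule_lin.
apply: lin_inc_ext => [||p' q' u]; [by multilin|by multilin|].
rewrite (tlift_colinear (h := fun x s => x \ox bipart p q s) _
  (@inc_colinear p' q')); last by multilin.
have [[ep eq]|ne] := eqVneq (p, q) (p', q'); last first.
  rewrite bipart_inc0 // (lin0 cl) /tlift big1 // => i _.
  by rewrite bipart_inc0 // (lin0 ((bilin_ox _ _).2 _)).
move: u; rewrite -ep -eq => u; rewrite bipart_inc -[LHS]tlift_id.
by apply: eq_tlift => x u0; rewrite bipart_inc.
Qed.

Lemma proj_bipart p q (v : cOm W (p + q)) : proj p q (cinc v) = bipart p q (cinc v).
Proof.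
rewrite /proj; case: xgetP => [u _ [f [fr -> fu]]|].
  rewrite (lin_sum _ _ _ (@bipart_lin p q)) /=.
  have pk : (p < (p + q).+1)%N by rewrite ltnS leq_addr.
  rewrite (bigD1 (Ordinal pk)) //= fu bipart_inc big1 ?addr0 // => i ip.
  have [x _ <-] := fr i; rewrite bipart_inc0 // xpair_eqE.
  by apply/nandP; left; rewrite eq_sym; rewrite -(inj_eq val_inj) in ip.
have [_ _ [_ /(_ _ v)[f vE] _] _ _] := WP.
have [u fu] := @Om_cast p _ q (f p) (addKn _ _).
move=> /(_ u)[]; exists (fun i => inc (f i)); split=> // i.
Qed.

Lemma delbar01E (w : Om W 0 1) : delbar w = bipart 0 2 (cd (inc w)).
Proof.
have [v ve] := inc_cinc w; have [_ [_ dk _ _] _ _] := calculusP.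
rewrite /delbar ve; by have [v' ->] := dk _ v; exact: (@proj_bipart 0 2).
Qed.

Lemma cB_cinc b : exists v : cOm W 0, cB W b = cinc v.
Proof.
have [[_ [_ r0 _ _ _]] _ _ _] := calculusP.
have : range (cB W) (cB W b) by exists b.
by rewrite r0 => -[v _ <-]; exists v.
Qed.

Lemma delbarBE b : delbarB W b = bipart 0 1 (cd (cB W b)).
Proof.
have [v ve] := cB_cinc b; have [_ [_ dk _ _] _ _] := calculusP.
by rewrite /delbarB ve; have [v' ->] := dk _ v; exact: (@proj_bipart 0 1).
Qed.

Lemma wedge01_inc (w v : Om W 0 1) : exists u : Om W 0 2,
  amul (inc w) (inc v) = inc u.
Proof. by case: WP => _ _ _ /(_ 0 1 0 1 w v). Qed.

Lemma wedge01E (w v : Om W 0 1) :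
  wedge w v = bipart 0 2 (amul (inc w) (inc v)).
Proof.
have [u ue] := wedge01_inc w v; rewrite /wedge ue.
by have [u' ->] := inc_cinc u; exact: (@proj_bipart 0 2).
Qed.

Lemma inc_wedge01 (w v : Om W 0 1) :
  inc (wedge w v : Om W 0 2) = amul (inc w) (inc v).
Proof. by rewrite wedge01E; have [u ->] := wedge01_inc w v; rewrite bipart_inc. Qed.

Let tot_mul_bilin : bilin (@amul R W).
Proof.
by case: total_algebraP => -[H1 H2 _ _ _] *; split=> *; [exact: H2|exact: H1].
Qed.

Let d_lin : lin (@cd _ _ _ W).
Proof. by case: calculusP => _ []. Qed.

Let cB_lin : lin (cB W).
Proof. by case: calculusP => -[_ [[]]]. Qed.

Let totA : associative (@amul R W).
Proof. by case: total_algebraP => -[]. Qed.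

Let bl02 := @bipart_lin 0 2.
Let bl01 := @bipart_lin 0 1.
Let il01 := @inc_lin 0 1.

Lemma delbar01_lin : lin (@delbar _ _ _ W 0 1 : Om W 0 1 -> Om W 0 2).
Proof.
have -> : @delbar _ _ _ W 0 1 = (fun w => bipart 0 2 (cd (inc w)))
  by apply: funext => w; exact: delbar01E.
by multilin.
Qed.

Lemma delbarB_lin : lin (@delbarB _ _ _ W).
Proof.
have -> : @delbarB _ _ _ W = (fun b => bipart 0 1 (cd (cB W b)))
  by apply: funext => w; exact: delbarBE.
by multilin.
Qed.

Lemma wedge01_bilin : bilin (@wedge _ _ _ W 0 1 0 1 : _ -> _ -> Om W 0 2).
Proof.
have -> : @wedge _ _ _ W 0 1 0 1 =
    (fun w v => bipart 0 2 (amul (inc w) (inc v)))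
  by do 2!apply: funext=> ?; exact: wedge01E.
by multilin.
Qed.

Lemma wedge01_ractl b (w v : Om W 0 1) :
  wedge (ract w b) v = wedge w (lact b v) :> Om W 0 2.
Proof. by apply: inc_inj; rewrite !inc_wedge01 inc_ract inc_lact totA. Qed.

Lemma wedge01_ractr b (w v : Om W 0 1) :
  wedge w (ract v b) = ract (wedge w v : Om W 0 2) b :> Om W 0 2.
Proof.
by apply: inc_inj; rewrite inc_wedge01 !inc_ract inc_wedge01 totA.
Qed.

Lemma d_bidegree p q (w : Om W p q) :
  exists (u : Om W p.+1 q) (v : Om W p q.+1), cd (inc w) = inc u + inc v.
Proof. by case: WP => _ _ _ _ [_]; exact. Qed.

Lemma d_cB b : exists (u : Om W 1 0) (v : Om W 0 1),
  cd (cB W b) = inc u + inc v.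
Proof.
have [v ->] := cB_cinc b; have [_ _ [_ dec _] _ _] := WP.
have [f ->] := dec 0 v; rewrite big_ord1.
exact: (d_bidegree (f 0 : Om W 0 0)).
Qed.

(** The (0,2)-part of d(w b) = d(w) b - w /\ d(b): the (1,1)-part of [d w] and the
    (1,0)-part of [d b] contribute only to bidegree (1,1). *)
Lemma delbar01_ract b (w : Om W 0 1) :
  delbar (ract w b) = ract (delbar w : Om W 0 2) b - wedge w (delbarB W b)
  :> Om W 0 2.
Proof.
rewrite !delbar01E inc_ract.
have [v wv] := inc_cinc w; have [_ [_ _ _ leib] _ _] := calculusP.
rewrite wv leib expr1 scaleN1r -wv.
have [u1 [u2 ->]] := d_bidegree w; have [v1 [v2 dB]] := d_cB b.
rewrite delbarBE dB (linD (tot_mul_bilin.1 _)) (linD (tot_mul_bilin.2 _)).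
rewrite -!inc_ract (linB bl02) !(linD bl02) (linD bl01).
have [x xE] : exists x : Om W 1 1, amul (inc w) (inc v1) = inc x.
  by case: WP => _ _ _ /(_ 0 1 1 0 w v1).
by rewrite xE !bipart_inc !(bipart_inc0 (p := 0)) // !add0r wedge01E.
Qed.

Lemma colinear_comp (U V Z : lmodType C) (cu : U -> tensC A U) (cv : V -> tensC A V)
    (cz : Z -> tensC A Z) (f : U -> V) (h : V -> Z) : lin h ->
  colinear cu cv f -> colinear cv cz h -> colinear cu cz (fun u => h (f u)).
Proof.
move=> hl fP hP u; rewrite hP.
by rewrite (tlift_colinear (h := fun x s => x \ox h s) _ fP) //; multilin.
Qed.

Let d_colinear : colinear (@coact R A W) (@coact R A W) (@cd _ _ _ W).
Proof. by case: calculusP. Qed.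

Let cB_colinear : colinear (@coact R A B) (@coact R A W) (cB W).
Proof. by case: calculusP => -[_ []]. Qed.

Lemma delbar01_colinear :
  colinear (@bcoact R A B (Om W 0 1)) (@bcoact R A B (Om W 0 2))
    (@delbar _ _ _ W 0 1).
Proof.
have -> : @delbar _ _ _ W 0 1 = (fun w => bipart 0 2 (cd (inc w)))
  by apply: funext => w; exact: delbar01E.
apply: colinear_comp bl02 _ (@bipart_colinear 0 2).
exact: colinear_comp d_lin (@inc_colinear _ _) d_colinear.
Qed.

Lemma delbarB_colinear :
  colinear (@coact R A B) (@bcoact R A B (Om W 0 1)) (@delbarB _ _ _ W).
Proof.
have -> : @delbarB _ _ _ W = (fun b => bipart 0 1 (cd (cB W b)))
  by apply: funext => w; exact: delbarBE.
apply: colinear_comp bl01 _ (@bipart_colinear 0 1).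
exact: colinear_comp d_lin cB_colinear d_colinear.
Qed.

Lemma wedge01_codiagonal :
  codiagonal (@bcoact R A B (Om W 0 1)) (@bcoact R A B (Om W 0 1))
    (@bcoact R A B (Om W 0 2)) (@wedge _ _ _ W 0 1 0 1).
Proof.
move=> w v; rewrite wedge01E bipart_colinear.
have ml := amul_bilin bialgA.
have totc : codiagonal (@coact R A W) (@coact R A W) (@coact R A W) (@amul R W).
  by case: total_algebraP.
have wl : lin (@coact R A W) by case: total_algebraP => _ /comodule_lin.
rewrite (tlift_codiagonal (h := fun x s => x \ox bipart 0 2 s) _ _ totc);
  last by multilin.
rewrite (tlift_colinear (h := fun x s => \Sw_(y, r <- coact (inc v))
  amul x y \ox bipart 0 2 (amul s r)) _ (@inc_colinear 0 1)); last by multilin.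
apply: eq_tlift => x w0.
rewrite (tlift_colinear (h := fun y r =>
  amul x y \ox bipart 0 2 (amul (inc w0) r)) _ (@inc_colinear 0 1)); last by multilin.
by apply: eq_tlift => y v0; rewrite wedge01E.
Qed.

End Complex.


(** * Holomorphic bimodules *)

Section Holomorphic.
Variables (R : realType) (A : hopf R) (B : coalg_algebra A).
Local Notation C := R[i].
Variable W : complex_structure B.
Variables (E : bimod B) (dE : E -> tensB (Om W 0 1) E).
Hypothesis BP : is_comodule_algebra B.
Hypothesis WP : is_cov_complex_structure W.
Hypothesis bialgA : is_bialgebra A.
Hypothesis dEP : is_cov_hol_bimodule dE.

Let EP : is_cov_bimodule E. Proof. by case: dEP. Qed.
Let dE_lin : lin dE. Proof. by case: dEP. Qed.
Let OP p q := OmP WP p q.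
Let Ec := bcoact_comodule EP.
Let El := comodule_lin Ec.
Let Oc p q := bcoact_comodule (OP p q).
Let Ol p q := comodule_lin (@Oc p q).
Let dbl := delbar01_lin WP.
Let wdl := wedge01_bilin WP.
Let tp1 := bilin_tpureB (OP 0 1) EP.
Let tp2 := bilin_tpureB (OP 0 2) EP.

(** The map w (x) (v (x)_B e) |-> (w /\ v) (x)_B e. *)
Definition wedge_tens (w : Om W 0 1) (t : tensB (Om W 0 1) E) :
    tensB (Om W 0 2) E :=
  \Sw_(v, e <- t) tpureB (wedge w v : Om W 0 2) e.

Let wt_bilin (w : Om W 0 1) :
  bilin (fun (v : Om W 0 1) (e : E) => tpureB (wedge w v : Om W 0 2) e).
Proof. by multilin. Qed.

Let wt_bal (w : Om W 0 1) (v : Om W 0 1) b (e : E) :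
  tpureB (wedge w (ract v b) : Om W 0 2) e =
  tpureB (wedge w v : Om W 0 2) (lact b e).
Proof. by rewrite -tpureB_bal (wedge01_ractr WP). Qed.

Lemma wedge_tens_pure (w : Om W 0 1) v e :
  wedge_tens w (tpureB v e) = tpureB (wedge w v : Om W 0 2) e.
Proof. exact: (tliftB_pure (wt_bilin w) (@wt_bal w)). Qed.

Lemma wedge_tens_bilin : bilin wedge_tens.
Proof.
split=> [t|w]; last exact: (lin_tliftB (wt_bilin w) (@wt_bal w)).
by apply: lin_tlift => v e; multilin.
Qed.
Let wtl := wedge_tens_bilin.

Lemma wedge_tens_bal (w : Om W 0 1) b t :
  wedge_tens (ract w b) t = wedge_tens w (lact b t).
Proof.
have tl := tensB_lact_bilin (OP 0 1) EP.
pose f (t : tensB (Om W 0 1) E) := wedge_tens w (lact b t).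
have fl : lin f by rewrite /f; multilin.
move: t; refine (tens_linP (wtl.2 (ract w b)) fl _) => v e; rewrite /f.
rewrite -/(tpureB v e) (tensB_lact_pure (OP 0 1) EP) !wedge_tens_pure.
by rewrite (wedge01_ractl WP).
Qed.

Let twf (w : Om W 0 1) (e : E) : tensB (Om W 0 2) E :=
  tpureB (delbar w : Om W 0 2) e - wedge_tens w (dE e).

Let twf_bilin : bilin twf. Proof. by rewrite /twf; multilin. Qed.

(* The defects of balancedness of the two terms are both (w /\ delbar b) (x) e. *)
Let twf_bal (w : Om W 0 1) b e : twf (ract w b) e = twf w (lact b e).
Proof.
have [_ _ _ leib _] := dEP.
rewrite /twf leib (delbar01_ract WP) (linB (tp2.1 e)) (linD (wtl.2 w)).
rewrite wedge_tens_bal wedge_tens_pure tpureB_bal.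
by rewrite -addrA -opprD [X in - X]addrC.
Qed.

Lemma delbar_twisted_lin : lin (delbar_twisted dE).
Proof. exact: (lin_tliftB twf_bilin twf_bal). Qed.

Lemma delbar_twisted_pure (w : Om W 0 1) e : delbar_twisted dE (tpureB w e) =
  tpureB (delbar w : Om W 0 2) e - wedge_tens w (dE e).
Proof. exact: (tliftB_pure twf_bilin twf_bal). Qed.

Variables g gb : {scalar tensC A A}.
Hypothesis gP : is_2cocycle g gb.
Local Notation gf := (fun x y : A => g (x \ox y) : C).
Local Notation Ag := (deform_hopf g gb).
Local Notation Bg := (deform_alg g gb B).
Local Notation Wg := (deform_complex g gb W).
Local Notation Eg := (Gamma g gb E).
Local Notation dEg := (deform_delbar g gb dE).
Local Notation phi1 := (phi g gb (Om W 0 1) E).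
Local Notation phi2 := (phi g gb (Om W 0 2) E).
Local Notation tpg1 := (@tpureB R Ag Bg (Om Wg 0 1) Eg).
Local Notation tpg2 := (@tpureB R Ag Bg (Om Wg 0 2) Eg).

Let gl : bilin (gf : A -> A -> C^o) := scalar_biform g.
Let phi1l := phi_lin BP bialgA gP (OP 0 1) EP.
Let phi2l := phi_lin BP bialgA gP (OP 0 2) EP.
Let psi1l := psi_lin BP bialgA gP (OP 0 1) EP.
Let Bc : is_comodule (@coact R A B). Proof. by case: BP. Qed.
Let Bl := comodule_lin Bc.

Lemma deform_delbarE e : dEg e = psi g gb (dE e).
Proof. exact: (phiV_psi BP bialgA gP (OP 0 1) EP). Qed.

Lemma phi_deform_delbar e : phi1 (dEg e) = dE e.
Proof. by rewrite deform_delbarE; exact: (psiK BP bialgA gP (OP 0 1) EP). Qed.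

(** The product of two (0,1)-forms is already a (0,2)-form, so the component taken
    by the deformed [wedge] does not alter the twisted product. *)
Lemma deform_wedge01 (w v : Om W 0 1) :
  (@wedge R Ag Bg Wg 0 1 0 1 w v : Om W 0 2) =
  twist (@bcoact R A B (Om W 0 1)) (@bcoact R A B (Om W 0 1)) gf
    (@wedge _ _ _ W 0 1 0 1) w v.
Proof.
have wl := comodule_lin (bcoact_comodule (OP 0 2)).
have tml : bilin (@amul R W).
  by case: (total_algebraP WP) => -[H1 H2 _ _ _] *; split=> *; [exact: H2|exact: H1].
have Wl : lin (@coact R A W) by case: (total_algebraP WP) => _ /comodule_lin.
have i1 := @inc_lin _ _ _ _ WP 0 1.
have ic := @inc_colinear _ _ _ _ WP 0 1.
pose u : Om W 0 2 := twist (@bcoact R A B (Om W 0 1))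
  (@bcoact R A B (Om W 0 1)) gf (@wedge _ _ _ W 0 1 0 1) w v.
have uE : twist (@coact R A W) (@coact R A W) gf (@amul R W) (inc w) (inc v)
    = inc u.
  rewrite (twist_colinearl _ _ _ ic) // (twist_colinearr _ _ _ ic) //; last by multilin.
  rewrite /u (twist_post _ _ _ _ _ _ (@inc_lin _ _ _ _ WP 0 2)).
  by apply: eq_twist => // *; rewrite (inc_wedge01 WP).
transitivity (@proj _ _ _ W 0 2 (inc u)); first by rewrite -uE.
by have [x xE] := inc_cinc WP u; rewrite xE (proj_bipart WP) -xE (bipart_inc WP).
Qed.

(** [twist_assoc] for the law (w /\ v) (x) e = w /\ (v (x) e), applied to each term
    of a representative of [t]. *)
Lemma phi_wedge_tens (w : Om W 0 1) (t : tensB (Om Wg 0 1) Eg) :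
  phi2 (\Sw_(v, e <- t) tpg2 (@wedge R Ag Bg Wg 0 1 0 1 w v) e) =
  twist (@bcoact R A B (Om W 0 1)) (@bcoact R A B (tensB (Om W 0 1) E)) gf
    wedge_tens w (phi1 t).
Proof.
have Tl := tensB_coact_lin BP bialgA (OP 0 1) EP.
have tl := twist_bilin (@Ol 0 1) Tl gl wtl.
rewrite (tlift_sum _ _ phi2l) -{2}[t]tlift_tpure (tlift_sum _ _ phi1l).
rewrite (tlift_sum _ _ (tl.2 w)); apply: eq_tlift => v e.
rewrite (phi_pure BP bialgA gP (OP 0 2) EP) deform_wedge01.
rewrite -/(tpg1 v e) (phi_pure BP bialgA gP (OP 0 1) EP).
apply: (twist_assoc bialgA gP (@Oc 0 1) (@Oc 0 1) Ec (@Ol 0 2) Tl wdl tp2 wtl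
  (wedge01_codiagonal WP bialgA) (tpureB_codiagonal BP bialgA (OP 0 1) EP)).
by move=> *; rewrite wedge_tens_pure.
Qed.

Let dE_colinear :
  colinear (@bcoact R A B E) (@bcoact R A B (tensB (Om W 0 1) E)) dE.
Proof. by case: dEP. Qed.

(** On a pure tensor w (x) e both sides are the twist of
    [delbar w (x) e - w /\ delbar_E e], by the colinearity of [delbar] and
    [delbar_E]. *)
Lemma phi_delbar_twisted (t : tensB (Om Wg 0 1) Eg) :
  phi2 (delbar_twisted dEg t) = delbar_twisted dE (phi1 t).
Proof.
have dtl := delbar_twisted_lin.
rewrite (tlift_sum _ _ phi2l) -{2}[t]tlift_tpure (tlift_sum _ _ phi1l).
rewrite (tlift_sum _ _ dtl); apply: eq_tlift => w e.
rewrite -/(tpg1 w e) (phi_pure BP bialgA gP (OP 0 1) EP).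
rewrite (twist_post _ _ _ _ _ _ dtl) (linB phi2l).
rewrite (phi_pure BP bialgA gP (OP 0 2) EP) phi_wedge_tens phi_deform_delbar.
rewrite (twist_colinearr _ _ _ dE_colinear) //.
transitivity (twist (@bcoact R A B (Om W 0 1)) (@bcoact R A B E) gf twf w e);
  last by apply: eq_twist => // *; rewrite delbar_twisted_pure.
rewrite twistB; congr (_ - _).
by rewrite -(twist_colinearl _ _ _ (delbar01_colinear WP)).
Qed.

Lemma deform_delbar_leibniz (b : B) (e : E) :
  dEg (@lact R Ag Bg Eg b e) =
  @lact R Ag Bg (tensB (Om Wg 0 1) Eg) b (dEg e) + tpg1 (@delbarB R Ag Bg Wg b) e.
Proof.
have [_ _ _ leib _] := dEP.
have inj1 := can_inj (phiK BP bialgA gP (OP 0 1) EP).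
have Tl := tensB_coact_lin BP bialgA (OP 0 1) EP.
have ltl := tensB_lact_bilin (OP 0 1) EP.
have dbBl := delbarB_lin WP.
apply: inj1; rewrite (linD phi1l) phi_deform_delbar.
rewrite (phi_lact BP bialgA gP (OP 0 1) EP) phi_deform_delbar.
rewrite (phi_pure BP bialgA gP (OP 0 1) EP).
transitivity (dE (twist (@coact R A B) (@bcoact R A B E) gf (@lact R A B E) b e)) => //.
rewrite (twist_post _ _ _ _ _ _ dE_lin).
transitivity (twist (@coact R A B) (@bcoact R A B E) gf
  (fun b e => lact b (dE e) + tpureB (delbarB W b) e) b e).
  exact: eq_twist.
rewrite twistD; congr (_ + _).
  by rewrite -(twist_colinearr _ _ _ dE_colinear).
by rewrite -(twist_colinearl _ _ _ (delbarB_colinear WP)).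
Qed.

Lemma deform_delbar_hol : is_cov_hol_bimodule dEg.
Proof.
split.
- exact: Gamma_cov_bimodule.
- move=> c u v; rewrite !deform_delbarE dE_lin; exact: psi1l.
- move=> e; rewrite deform_delbarE (psi_coact BP bialgA gP (OP 0 1) EP).
  have hl : bilin (fun (x : A) s => x \ox psi g gb (s : tensB (Om W 0 1) E)).
    by multilin.
  rewrite (tlift_colinear _ dE_colinear hl).
  by apply: eq_tlift => x e0; rewrite deform_delbarE.
- exact: deform_delbar_leibniz.
- move=> e; apply: (can_inj (phiK BP bialgA gP (OP 0 2) EP)).
  rewrite [LHS]phi_delbar_twisted phi_deform_delbar (lin0 phi2l).
  by case: dEP => _ _ _ _ /(_ e).
Qed.

End Holomorphic.

Theorem theorem5p6 (R : realType) (A : hopf R) (B : coalg_algebra A)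
    (Omega : complex_structure B)
    (E : bimod B) (dE : E -> tensB (Om Omega 0 1) E)
    (g gb : {scalar tensC A A}) :
  is_hopf_star_algebra A ->
  is_comodule_star_algebra B ->
  is_cov_complex_structure Omega ->
  is_cov_hol_bimodule dE ->
  is_unitary_2cocycle g gb ->
  bijective (phi g gb (Om Omega 0 1) E) /\
  is_cov_hol_bimodule (deform_delbar g gb dE).
Proof.
move=> [[bialgA _ _ _ _] _ _] [BP _ _] OmegaP dEP [gP _]; split.
  by apply: (phi_bijective BP bialgA gP); [exact: OmP | case: dEP].
exact: deform_delbar_hol.
Qed.
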